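(* For every channel coefficient vector $H=(h_{11},h_{12},h_{21},h_{22})\in\mathbb{C}^4$, the region $\mathbf{C}_{\rm inner}(H)$ defined below is achievable over the Gaussian interference channel with common information, i.e. $\mathbf{C}_{\rm inner}(H)\subseteq \mathbf{C}(H)$, where $\mathbf{C}(H)$ is its capacity region.
   Context: Gaussian interference channel with common information (IC-CI): two transmitters T1, T2 and two receivers R1, R2. At time $t$, $Y_1(t)=h_{11}X_1(t)+h_{12}X_2(t)+Z_1(t)$ and $Y_2(t)=h_{21}X_1(t)+h_{22}X_2(t)+Z_2(t)$, where $X_i(t)\in\mathbb{C}$ is sent by T$i$, $Y_i(t)\in\mathbb{C}$ is received by R$i$, $Z_1(t),Z_2(t)\sim\mathcal{CN}(0,1)$ are noises, i.i.d. over time and independent of the messages, and $H=(h_{11},h_{12},h_{21},h_{22})\in\mathbb{C}^4$ is deterministic and known to all terminals. An $(n,R_0,R_1,R_2,P_e^{(n)})$ code consists of: independent messages $\mathcal{M}_0,\mathcal{M}_1,\mathcal{M}_2$, with $\mathcal{M}_k$ uniform on $\{1,\dots,2^{nR_k}\}$ ($\mathcal{M}_0$ is the common message, $\mathcal{M}_i$ the individual message for receiver $i$); encoders $X_i(t)=f_i(\mathcal{M}_0,\mathcal{M}_i,t,H)$, $t=1,\dots,n$, satisfying $\frac1n\sum_{t=1}^n\mathbb{E}|X_i(t)|^2\le 1$, $i=1,2$; decoders $(\hat M_{0i},\hat M_i)=g_i(Y_i^n,H)$ at receiver $i$, where $Y_i^n=(Y_i(1),\dots,Y_i(n))$; and error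 probability $P_e^{(n)}=\Pr\{\mathcal{M}_1\ne\hat M_1\text{ or }\mathcal{M}_2\ne\hat M_2\text{ or }\mathcal{M}_0\ne\hat M_{01}\text{ or }\mathcal{M}_0\ne\hat M_{02}\}$. A triple $(R_0,R_1,R_2)$ is achievable if there is a sequence of such codes with $P_e^{(n)}\to0$ as $n\to\infty$; the capacity region $\mathbf{C}(H)$ is the closure of the set of achievable triples. Let $\mathsf{C}(P)=\log_2(1+P)$ for $P\ge0$. Define $x_{21}=\min(1,1/|h_{21}|^2)$, $x_{12}=\min(1,1/|h_{12}|^2)$ and $A_1=\mathsf{C}\!\left(\frac{|h_{11}|^2x_{21}}{1+|h_{12}|^2x_{12}}\right)$, $A_2=\mathsf{C}\!\left(\frac{|h_{22}|^2x_{12}}{1+|h_{21}|^2x_{21}}\right)$, $D_1=\mathsf{C}\!\left(\frac{|h_{11}|^2}{1+|h_{12}|^2x_{12}}\right)$, $D_2=\mathsf{C}\!\left(\frac{|h_{22}|^2}{1+|h_{21}|^2x_{21}}\right)$, $E_1=\mathsf{C}\!\left(\frac{|h_{11}|^2x_{21}+|h_{12}|^2(1-x_{12})}{1+|h_{12}|^2x_{12}}\right)$, $E_2=\mathsf{C}\!\left(\frac{|h_{22}|^2x_{12}+|h_{21}|^2(1-x_{21})}{1+|h_{21}|^2x_{21}}\right)$, $G_1=\mathsf{C}\!\left(\frac{|h_{11}|^2+|h_{12}|^2(1-x_{12})}{1+|h_{12}|^2x_{12}}\right)$, $G_2=\mathsf{C}\!\left(\frac{|h_{22}|^2+|h_{21}|^2(1-x_{21})}{1+|h_{21}|^2x_{21}}\right)$,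 $G_1'=\mathsf{C}\!\left(\frac{1+|h_{11}|^2+|h_{12}|^2}{1+|h_{12}|^2x_{12}}-1\right)$, $G_2'=\mathsf{C}\!\left(\frac{1+|h_{22}|^2+|h_{21}|^2}{1+|h_{21}|^2x_{21}}-1\right)$. $\mathbf{C}_{\rm inner}(H)$ is the set of $(R_0,R_1,R_2)$ with $R_0,R_1,R_2\ge0$ and $R_0+R_1\le G_1'$, $R_0+R_2\le G_2'$, $R_1\le D_1$, $R_2\le D_2$, $R_1+R_2\le E_1+E_2$, $R_1+R_2\le A_1+G_2$, $R_1+R_2\le A_2+G_1$, $R_0+R_1+R_2\le A_1+G_2'$, $R_0+R_1+R_2\le A_2+G_1'$, $2R_1+R_2\le A_1+G_1+E_2$, $R_1+2R_2\le A_2+G_2+E_1$, $R_0+2R_1+R_2\le A_1+G_1'+E_2$, $R_0+R_1+2R_2\le A_2+G_2'+E_1$. *)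

(* Defs.v *)
From HB Require Import structures.
From mathcomp Require Import all_boot all_order all_algebra.
From mathcomp Require Import all_classical all_reals all_analysis.
From mathcomp Require Import complex.
Set Implicit Arguments. Unset Strict Implicit. Unset Printing Implicit Defensive.
Import Order.TTheory GRing.Theory Num.Theory ComplexField.
Import numFieldTopology.Exports.
Local Open Scope classical_set_scope.
Local Open Scope ring_scope.
Local Open Scope complex_scope.

Section ICCI.
Variable R : realType.

Definition sqmod (h : R[i]) : R := (complex.Re h) ^+ 2 + (complex.Im h) ^+ 2.

Definition Ccap (P : R) : R := ln (1 + P) / ln 2.

Definition nmsg (n : nat) (r : R) : nat := `|Num.floor (2 `^ (n%:R * r))|%N.

(** standard deviation of the real and of the imaginary part of CN(0,1) *)
Definition cn_sd : R := Num.sqrt (2^-1).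

(** Gaussian noise expectation: [noise_exp k phi] is the expectation of
    phi [:: (Z1(0),Z2(0)); ...; (Z1(k-1),Z2(k-1))] where all Z's are i.i.d.
    circularly-symmetric CN(0,1), i.e. real and imaginary parts are
    independent N(0,1/2).  Written as an iterated Lebesgue integral against
    the normal distribution [normal_prob 0 cn_sd]. *)
Fixpoint noise_exp (k : nat) (phi : seq (R[i] * R[i]) -> \bar R) : \bar R :=
  match k with
  | 0 => phi [::]
  | k'.+1 =>
    (\int[normal_prob 0 cn_sd]_a \int[normal_prob 0 cn_sd]_b
     \int[normal_prob 0 cn_sd]_c \int[normal_prob 0 cn_sd]_d
       noise_exp k' (fun s => phi ((a +i* b, c +i* d) :: s)))%E
  end.

Definition of_pairs n (y : n.-tuple (R * R)) : n.-tuple R[i] :=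
  [tuple (tnth y t).1 +i* (tnth y t).2 | t < n].

Section Code.
Variables (h11 h12 h21 h22 : R[i]) (n : nat) (r0 r1 r2 : R).

Local Notation M0 := (nmsg n r0).
Local Notation M1 := (nmsg n r1).
Local Notation M2 := (nmsg n r2).

(** an (n, R0, R1, R2) code for the IC-CI with channel H (known to all
    terminals, hence the encoders/decoders may depend on it) *)
Record code := Code {
  enc1 : 'I_M0 -> 'I_M1 -> 'I_n -> R[i];
  enc2 : 'I_M0 -> 'I_M2 -> 'I_n -> R[i];
  dec1 : n.-tuple R[i] -> 'I_M0 * 'I_M1;
  dec2 : n.-tuple R[i] -> 'I_M0 * 'I_M2;
  power1 : n%:R^-1 * \sum_(t < n)
             ((M0 * M1)%:R^-1 * \sum_(m0 < M0) \sum_(m1 < M1)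
                 sqmod (enc1 m0 m1 t)) <= 1;
  power2 : n%:R^-1 * \sum_(t < n)
             ((M0 * M2)%:R^-1 * \sum_(m0 < M0) \sum_(m2 < M2)
                 sqmod (enc2 m0 m2 t)) <= 1;
  dec1_meas : forall m, measurable [set y : n.-tuple (R * R) | dec1 (of_pairs y) = m];
  dec2_meas : forall m, measurable [set y : n.-tuple (R * R) | dec2 (of_pairs y) = m]
}.

Definition recv1 (c : code) m0 m1 m2 (s : seq (R[i] * R[i])) : n.-tuple R[i] :=
  [tuple h11 * enc1 c m0 m1 t + h12 * enc2 c m0 m2 t + (nth (0, 0) s t).1 | t < n].
Definition recv2 (c : code) m0 m1 m2 (s : seq (R[i] * R[i])) : n.-tuple R[i] :=
  [tuple h21 * enc1 c m0 m1 t + h22 * enc2 c m0 m2 t + (nth (0, 0) s t).2 | t < n].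

Definition err_prob (c : code) : \bar R :=
  ((M0 * M1 * M2)%:R^-1)%:E *
  (\sum_(m0 < M0) \sum_(m1 < M1) \sum_(m2 < M2)
     noise_exp n (fun s =>
       (if (dec1 c (recv1 c m0 m1 m2 s) != (m0, m1))
           || (dec2 c (recv2 c m0 m1 m2 s) != (m0, m2))
        then 1 else 0)%:E))%E.

End Code.

Definition achievable (h11 h12 h21 h22 : R[i]) (r0 r1 r2 : R) : Prop :=
  0 <= r0 /\ 0 <= r1 /\ 0 <= r2 /\
  exists c : forall n : nat, code n r0 r1 r2,
    (fun n => err_prob h11 h12 h21 h22 (c n)) @ \oo --> 0%E.

Definition capacity_region (h11 h12 h21 h22 : R[i]) : set (R * R * R) :=
  closure [set r | achievable h11 h12 h21 h22 r.1.1 r.1.2 r.2].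

Section Inner.
Variables h11 h12 h21 h22 : R[i].
Let a11 := sqmod h11. Let a12 := sqmod h12.
Let a21 := sqmod h21. Let a22 := sqmod h22.
(* min(1, 1/|h21|^2), with 1/0 = +oo *)
Definition x21 : R := if a21 <= 1 then 1 else a21^-1.
Definition x12 : R := if a12 <= 1 then 1 else a12^-1.
Definition A1 := Ccap (a11 * x21 / (1 + a12 * x12)).
Definition A2 := Ccap (a22 * x12 / (1 + a21 * x21)).
Definition D1 := Ccap (a11 / (1 + a12 * x12)).
Definition D2 := Ccap (a22 / (1 + a21 * x21)).
Definition E1 := Ccap ((a11 * x21 + a12 * (1 - x12)) / (1 + a12 * x12)).
Definition E2 := Ccap ((a22 * x12 + a21 * (1 - x21)) / (1 + a21 * x21)).
Definition G1 := Ccap ((a11 + a12 * (1 - x12)) / (1 + a12 * x12)).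
Definition G2 := Ccap ((a22 + a21 * (1 - x21)) / (1 + a21 * x21)).
Definition G1' := Ccap ((1 + a11 + a12) / (1 + a12 * x12) - 1).
Definition G2' := Ccap ((1 + a22 + a21) / (1 + a21 * x21) - 1).

Definition C_inner : set (R * R * R) :=
  [set r | let: (R0, R1, R2) := r in
    0 <= R0 /\ 0 <= R1 /\ 0 <= R2 /\
    R0 + R1 <= G1' /\ R0 + R2 <= G2' /\ R1 <= D1 /\ R2 <= D2 /\
    R1 + R2 <= E1 + E2 /\ R1 + R2 <= A1 + G2 /\ R1 + R2 <= A2 + G1 /\
    R0 + R1 + R2 <= A1 + G2' /\ R0 + R1 + R2 <= A2 + G1' /\
    2 * R1 + R2 <= A1 + G1 + E2 /\ R1 + 2 * R2 <= A2 + G2 + E1 /\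
    R0 + 2 * R1 + R2 <= A1 + G1' + E2 /\
    R0 + R1 + 2 * R2 <= A2 + G2' + E1].
End Inner.

End ICCI.

(* Main.v *)
(** Random coding with Gaussian codebooks and superposition.  User [i] sends [U_i + V_i]: the
    cloud centre [U_i] is indexed by the common message and a public part of the individual
    message, the satellite [V_i] by the common message and the whole individual message.
    Receiver 1 decodes [(M0, M1)] jointly with the public part of [M2] by a typicality test and
    treats [V_2] as noise.  The indicator of every error event is dominated by the exponential
    of a quadratic form in the Gaussian variables.  Integrating out the wrong codewords first
    turns it into a constant [rho ^ n], and [rho < 1] is exactly the rate condition of that
    event.

    With the private powers [x21] and [x12], eliminating the rates of the private parts yields
    the inequalities of [C_inner] together with [R1 <= A1 + E2] and [R2 <= A2 + E1].  When
    [R1 > A1 + E2], user 1 instead puts its whole power and message into [V_1], and the message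
    of user 2 becomes entirely public. *)
Require Import Defs.
From HB Require Import structures.
From mathcomp Require Import all_boot all_order all_algebra.
From mathcomp Require Import all_classical all_reals all_analysis.
From mathcomp Require Import measurable_realfun complex.
From mathcomp Require Import ring lra.
Set Implicit Arguments. Unset Strict Implicit. Unset Printing Implicit Defensive.
Import Order.TTheory GRing.Theory Num.Theory.
Import numFieldNormedType.Exports.
Local Open Scope classical_set_scope.
Local Open Scope ring_scope.

(** * Iterated Gaussian integrals *)

(** The error probability is given by nested one-dimensional integrals, and the codebooks are
    averaged in the same way: every codeword and noise symbol is a pair of coordinates of one
    function, integrated coordinate by coordinate, with no product measure on codebooks. Once the
    mean is below a bound, some codebook is below it too.

    Two features of the statement shape the rest. The power constraint must hold for the chosen
    code, not just in the mean over codebooks; codebooks therefore have power [th < 1], so that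
    excessive energy is exponentially rare. And rates or channel gains may vanish, so that a strict
    rate condition could read [0 < 0]. Every such condition carries the alternative that the rate is
    zero, and the message sets are built so that the corresponding error event is then empty.

    Strict inequalities are affordable because the capacity region is a closure: rates shrink by a
    factor [k < 1], powers by [th = (1 + k) / 2], and by concavity of the logarithm each capacity
    keeps at least the fraction [th] of its value. *)

Section Integration.
Variable R : realType.
Local Notation mu := (@lebesgue_measure R).
Local Open Scope ereal_scope.

(* The integral of a nonnegative function is a supremum over the simple functions below it. *)
Lemma ge0_le_integral_nonmeas d (T : measurableType d)
    (m : {measure set T -> \bar R}) (f g : T -> \bar R) :
  (forall x, 0 <= f x) -> (forall x, f x <= g x) ->
  \int[m]_x f x <= \int[m]_x g x.
Proof.
move=> f0 fg.
have g0 x : 0 <= g x := le_trans (f0 x) (fg x).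
rewrite !ge0_integralTE//; apply: le_ereal_sup => _ [h hf <-].
by exists h => // x; exact: le_trans (hf x) (fg x).
Qed.

Import HBNNSimple.

(** The law is defined through its density on sets; the identity passes from indicators to simple
    functions and then to monotone limits. *)
Lemma integral_normal_prob (m s : R) (f : R -> \bar R) :
  measurable_fun setT f -> (forall x, 0 <= f x) ->
  \int[normal_prob m s]_x f x = \int[mu]_x (f x * (normal_pdf m s x)%:E).
Proof.
move=> mf f0.
have mp : measurable_fun [set: R] (fun x => (normal_pdf m s x)%:E).
  by apply/measurable_EFinP; exact: measurable_normal_pdf.
have p0 x : 0 <= (normal_pdf m s x)%:E by rewrite lee_fin normal_pdf_ge0.
have Hind (E : set R) : measurable E ->
    \int[normal_prob m s]_x (\1_E x)%:E = \int[mu]_x ((\1_E x)%:E * (normal_pdf m s x)%:E).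
  move=> mE; rewrite integral_indic// setIT /normal_prob [LHS]integral_mkcond.
  apply: eq_integral => x _; rewrite patchE indicE.
  by case: ifPn => xE; rewrite ?mul1e ?mul0e.
have Hsf (h : {nnsfun R >-> R}) :
    \int[normal_prob m s]_x (h x)%:E = \int[mu]_x ((h x)%:E * (normal_pdf m s x)%:E).
  have mi (r : R) : measurable_fun [set: R] (fun x => (r * \1_(h @^-1` [set r]) x)%:E).
    by apply/measurable_EFinP; apply: measurable_funM => //; exact: measurable_indic.
  under [LHS]eq_integral do rewrite fimfunE -fsumEFin//.
  rewrite [LHS]ge0_integral_fsum//; last first.
    - by move=> n x _; rewrite EFinM nnfun_muleindic_ge0.
  under [RHS]eq_integral.
    move=> x xD; rewrite fimfunE -fsumEFin// muleC ge0_mule_fsumr; last first.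
      by move=> r; rewrite EFinM nnfun_muleindic_ge0.
    over.
  rewrite [RHS]ge0_integral_fsum//; last 2 first.
    - by move=> r; apply: emeasurable_funM => //; exact: mi.
    - by move=> n x _; rewrite EFinM mule_ge0// nnfun_muleindic_ge0.
  apply: eq_fsbigr => r _.
  have [r0|r0] := ltP r 0%R.
    rewrite (_ : h @^-1` [set r] = set0) ?indic0; last first.
      by rewrite -subset0 => x /= hx; move: r0; rewrite -hx ltNge fun_ge0.
    by rewrite !integral0_eq// => x _; rewrite mulr0 ?mule0.
  have mI : measurable_fun [set: R] (fun x => (\1_(h @^-1` [set r]) x : R)%:E).
    by apply/measurable_EFinP; exact: measurable_indic.
  transitivity (r%:E * \int[normal_prob m s]_x (\1_(h @^-1` [set r]) x)%:E).
    by rewrite -ge0_integralZl.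
  rewrite Hind// -ge0_integralZl//.
  - by apply: eq_integral => x _; rewrite EFinM muleA muleC.
  - by apply: emeasurable_funM.
  - by move=> x _; rewrite mule_ge0// lee_fin.
pose f_ := nnsfun_approx measurableT mf.
have mf_ n : measurable_fun [set: R] (fun x => (f_ n x)%:E) by exact/measurable_EFinP.
have ndf (x : R) n k : (n <= k)%N -> (f_ n x)%:E <= (f_ k x)%:E.
  by move=> nk; rewrite lee_fin; exact/lefP/nd_nnsfun_approx.
transitivity (lim (\int[normal_prob m s]_x (f_ n x)%:E @[n --> \oo])).
  rewrite -monotone_convergence//=.
  - by apply: eq_integral => x _; apply/esym/cvg_lim => //=; exact: cvg_nnsfun_approx.
  - by move=> n ? _; rewrite lee_fin.
  - by move=> x _ a b; exact: ndf.
transitivity (lim (\int[mu]_x ((f_ n x)%:E * (normal_pdf m s x)%:E) @[n --> \oo])).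
  by apply: congr_lim; apply/funext => n; exact: Hsf.
rewrite -monotone_convergence//=.
- apply: eq_integral => x _; apply/cvg_lim => //=.
  by apply: cvgeZr => //; exact: cvg_nnsfun_approx.
- by move=> n; apply: emeasurable_funM => //; exact: mf_.
- by move=> n x _; rewrite mule_ge0// lee_fin.
- move=> x _ a b ab; apply: lee_wpmul2r => //.
  exact: ndf.
Qed.

Local Notation gam := (normal_prob 0 (@cn_sd R)).

(** Completing the square turns the integrand times the density of variance 1/2 into a multiple of
    the normal density with mean [- b / (1 + k)] and variance [1 / (2 * (1 + k))]. Negative [k]
    occurs in the bounds on upper tails. *)
Lemma integral_gauss_quad (k b : R) : (-1 < k)%R ->
  \int[gam]_a (expR (- (k * a ^+ 2 + 2 * b * a)))%:E =
  ((Num.sqrt (1 + k))^-1 * expR (b ^+ 2 / (1 + k)))%:E.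
Proof.
move=> k1; have k0 : (0 < 1 + k)%R by lra.
rewrite integral_normal_prob; last 2 first.
- apply/measurable_EFinP/measurableT_comp => //.
  apply: measurable_funN; apply: measurable_funD; apply: measurable_funM => //.
- by move=> x; rewrite lee_fin expR_ge0.
set c := ((Num.sqrt (1 + k))^-1 * expR (b ^+ 2 / (1 + k)))%R.
pose s : R := Num.sqrt (2 * (1 + k))^-1.
have s2 : (s ^+ 2 = (2 * (1 + k))^-1)%R by rewrite sqr_sqrtr// invr_ge0; lra.
have s0 : (s != 0)%R by rewrite gt_eqF// sqrtr_gt0 invr_gt0; lra.
have d2 : ((@cn_sd R) ^+ 2 = 2^-1)%R by rewrite sqr_sqrtr// invr_ge0.
have d0 : ((@cn_sd R) != 0)%R by rewrite gt_eqF// sqrtr_gt0 invr_gt0.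
have c0 : (0 <= c)%R by rewrite mulr_ge0 ?expR_ge0// invr_ge0.
have square (x : R) : (- (k * x ^+ 2 + 2 * b * x) + - (x - 0) ^+ 2 / (2^-1 *+ 2) =
    b ^+ 2 / (1 + k) + - (x - - (b / (1 + k))) ^+ 2 / ((2 * (1 + k))^-1 *+ 2))%R.
  have -> : (2^-1 *+ 2 = 1 :> R)%R by rewrite -mulr_natl; field.
  have -> : ((2 * (1 + k))^-1 *+ 2 = (1 + k)^-1 :> R)%R.
    by rewrite -mulr_natl; field; rewrite gt_eqF.
  rewrite invrK; field; by rewrite gt_eqF.
transitivity (\int[mu]_x (c%:E * (normal_pdf (- (b / (1 + k))) s x)%:E)).
  apply: eq_integral => x _; rewrite -!EFinM; congr (_%:E).
  rewrite !normal_pdfE// /normal_peak s2 d2 /normal_fun s2 d2 /c.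
  have -> : ((2 * (1 + k))^-1 * pi *+ 2 = (1 + k)^-1 * pi :> R)%R.
    by rewrite -mulr_natl; field; rewrite gt_eqF.
  have -> : (2^-1 * pi *+ 2 = pi :> R)%R by rewrite -mulr_natl; field.
  rewrite sqrtrM ?invr_ge0 ?(ltW k0)// sqrtrV ?(ltW k0)//.
  have sk : (Num.sqrt (1 + k) != 0)%R by rewrite gt_eqF// sqrtr_gt0.
  have sp : (Num.sqrt (pi : R) != 0)%R by rewrite gt_eqF// sqrtr_gt0 pi_gt0.
  rewrite mulrCA -expRD.
  rewrite [RHS](_ : _ = ((Num.sqrt pi)^-1 * (expR (b ^+ 2 / (1 + k)) *
     expR (- (x - - (b / (1 + k))) ^+ 2 / ((2 * (1 + k))^-1 *+ 2))))%R); last first.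
    by field; rewrite sk sp.
  rewrite -expRD; congr (_ * expR _)%R.
  exact: square.
rewrite ge0_integralZl//.
- by rewrite integral_normal_pdf mule1.
- by apply/measurable_EFinP; exact: measurable_normal_pdf.
- by move=> x _; rewrite lee_fin normal_pdf_ge0.
Qed.

End Integration.

(** * Iterated expectation over finitely many Gaussian coordinates *)

Section Expectation.
Variables (R : realType) (I : eqType).
Local Notation gam := (normal_prob 0 (@cn_sd R)).
Local Open Scope ereal_scope.
Implicit Types (x : I -> R) (s : seq I) (f g : (I -> R) -> \bar R).

Definition upd x i (a : R) : I -> R := fun j => if j == i then a else x j.

(** The head of [s] is the outermost integral, and coordinates outside [s] keep their value in [x].
    The nesting mirrors [noise_exp]. *)
Fixpoint Ex s f x : \bar R :=
  if s is i :: s' then \int[gam]_a Ex s' f (upd x i a) else f x.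

(* Measurability is tested by substituting measurable functions for the coordinates, which
   avoids putting a sigma-algebra on [I -> R]. *)
Definition nice f := (forall x, 0 <= f x) /\
  forall d (T : measurableType d) (g : I -> T -> R),
    (forall i, measurable_fun setT (g i)) ->
    measurable_fun setT (fun t => f (fun i => g i t)).

Lemma updC x i j a b : i != j -> upd (upd x i a) j b = upd (upd x j b) i a.
Proof.
move=> ij; apply/funext => k; rewrite /upd; case: (eqVneq k j) => // ->.
by rewrite eq_sym (negbTE ij).
Qed.

Lemma Ex_cat s1 s2 f x : Ex (s1 ++ s2) f x = Ex s1 (Ex s2 f) x.
Proof.
elim: s1 x => //= i s1 IH x; apply: eq_integral => a _; exact: IH.
Qed.

Lemma Ex_ge0 s f x : (forall x, 0 <= f x) -> 0 <= Ex s f x.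
Proof.
move=> f0; elim: s x => //= i s IH x.
by apply: integral_ge0 => a _.
Qed.

(** Comparing only at points that agree with [x] off [s] lets whatever depends on the other
    coordinates count as a constant. *)
Lemma eq_Ex s f g x : (forall y, (forall i, i \notin s -> y i = x i) -> f y = g y) ->
  Ex s f x = Ex s g x.
Proof.
elim: s x => [|i s IH] x fg /=; first exact: fg.
apply: eq_integral => a _; apply: IH => y yx; apply: fg => j.
rewrite inE negb_or => /andP[ji js]; rewrite yx// /upd (negbTE ji)//.
Qed.

Lemma le_Ex s f g x : (forall y, 0 <= f y) ->
  (forall y, (forall i, i \notin s -> y i = x i) -> f y <= g y) ->
  Ex s f x <= Ex s g x.
Proof.
move=> f0; elim: s x => [|i s IH] x fg /=; first exact: fg.
apply: ge0_le_integral_nonmeas => a; first exact: Ex_ge0.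
apply: IH => y yx; apply: fg => j.
by rewrite inE negb_or => /andP[ji js]; rewrite yx// /upd (negbTE ji).
Qed.

Lemma integral_gauss_cst (c : R) : \int[gam]_a c%:E = c%:E.
Proof.
have H : gam [set: measurableTypeR R] = 1.
  exact: (@probability_setT _ _ _ [the probability _ _ of gam]).
by rewrite integral_cst// [X in _ * X]H mule1.
Qed.

Lemma Ex_cst s (c : R) x : Ex s (fun=> c%:E) x = c%:E.
Proof.
elim: s x => //= i s IH x; under eq_integral do rewrite IH.
exact: integral_gauss_cst.
Qed.

Lemma nice_upd f i : nice f -> forall d (T : measurableType d) (g : I -> T -> R),
  (forall j, measurable_fun setT (g j)) ->
  measurable_fun setT (fun z : T * measurableTypeR R => f (upd (g ^~ z.1) i z.2)).
Proof.
move=> [_ mf] d T g mg.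
apply: (mf _ _ (fun j (z : T * measurableTypeR R) => if j == i then z.2 else g j z.1)) => j.
by case: eqP => _; [exact: measurable_snd|exact: measurableT_comp].
Qed.

Lemma nice_int f i : nice f -> nice (fun x => \int[gam]_a f (upd x i a)).
Proof.
move=> nf; split=> [x|d T g mg]; first by apply: integral_ge0 => a _; exact: nf.1.
exact: (measurable_fun_fubini_tonelli_F _ (nice_upd i nf mg) (fun z => nf.1 _)).
Qed.

Lemma nice_Ex s f : nice f -> nice (Ex s f).
Proof. by move=> nf; elim: s => //= i s IH; exact: nice_int. Qed.

Lemma nice_slice f i x : nice f ->
  measurable_fun [set: measurableTypeR R] (fun a => f (upd x i a)).
Proof.
move=> [_ mf]; apply: (mf _ _ (fun j a => upd x i a j)) => j.
by rewrite /upd; case: eqP.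
Qed.

Lemma Ex_swap i j s f x : nice f -> Ex [:: i, j & s] f x = Ex [:: j, i & s] f x.
Proof.
move=> nf; have [->//|ij] := eqVneq i j; rewrite /=.
have nE := nice_Ex s nf.
pose F (z : measurableTypeR R * measurableTypeR R) := Ex s f (upd (upd x i z.1) j z.2).
have mF : measurable_fun setT F.
  apply: (nice_upd j nE (g := fun k (a : measurableTypeR R) => upd x i a k)) => k.
  by rewrite /upd; case: eqP.
have F0 z : 0 <= F z by exact: nE.1.
etransitivity; first exact: (fubini_tonelli F mF F0).
by apply: eq_integral => b _; apply: eq_integral => a _; rewrite /F updC.
Qed.

Lemma Ex_front i s1 s2 f x : nice f ->
  Ex (s1 ++ i :: s2) f x = Ex (i :: s1 ++ s2) f x.
Proof.
move=> nf; elim: s1 x => // j s1 IH x.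
rewrite cat_cons -[_ :: _ ++ s2]/(i :: j :: s1 ++ s2) -Ex_swap//.
by apply: eq_integral => a _; exact: IH.
Qed.

(** Tonelli, one transposition at a time. This is what allows chosen blocks to be integrated
    innermost. *)
Lemma Ex_perm s1 s2 f x : nice f -> perm_eq s1 s2 -> Ex s1 f x = Ex s2 f x.
Proof.
move=> nf; elim: s1 s2 x => [|i s1 IH] s2 x.
  by rewrite perm_sym => /perm_nilP ->.
move=> ps; have is2 : i \in s2 by rewrite -(perm_mem ps) mem_head.
case/splitPr: is2 ps => p1 p2; rewrite perm_sym -cat1s perm_catCA/= perm_cons perm_sym.
move=> /IH ps; rewrite Ex_front//=; apply: eq_integral => a _; exact: ps.
Qed.

Lemma niceD f g : nice f -> nice g -> nice (fun x => f x + g x).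
Proof.
move=> [f0 mf] [g0 mg]; split=> [x|d T h mh]; first exact: adde_ge0.
by apply: emeasurable_funD; [exact: mf|exact: mg].
Qed.

Lemma nice_sum (J : Type) (r : seq J) (P : pred J) (F : J -> (I -> R) -> \bar R) :
  (forall j, nice (F j)) -> nice (fun x => \sum_(j <- r | P j) F j x).
Proof.
move=> nF; split=> [x|d T h mh]; first by apply: sume_ge0 => j _; exact: (nF j).1.
under eq_fun do rewrite big_mkcond/=.
apply: emeasurable_sum => j; case: (P j) => //; exact: (nF j).2.
Qed.

Lemma niceZ (c : R) f : (0 <= c)%R -> nice f -> nice (fun x => c%:E * f x).
Proof.
move=> c0 [f0 mf]; split=> [x|d T h mh]; first by rewrite mule_ge0.
by apply: measurable_funeM; exact: mf.
Qed.

Lemma ExD s f g x : nice f -> nice g ->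
  Ex s (fun y => f y + g y) x = Ex s f x + Ex s g x.
Proof.
move=> nf ng; elim: s x => //= i s IH x.
under eq_integral do rewrite IH.
have nEf := nice_Ex s nf; have nEg := nice_Ex s ng.
rewrite ge0_integralD//.
- by move=> a _; exact: nEf.1.
- exact: nice_slice.
- by move=> a _; exact: nEg.1.
- exact: nice_slice.
Qed.

Lemma ExZ s (c : R) f x : (0 <= c)%R -> nice f ->
  Ex s (fun y => c%:E * f y) x = c%:E * Ex s f x.
Proof.
move=> c0 nf; elim: s x => //= i s IH x.
under eq_integral do rewrite IH.
have nEf := nice_Ex s nf.
rewrite ge0_integralZl//.
- exact: nice_slice.
- by move=> a _; exact: nEf.1.
Qed.

Lemma Ex_sum (J : Type) (r : seq J) (P : pred J) (F : J -> (I -> R) -> \bar R) s x :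
  (forall j, nice (F j)) ->
  Ex s (fun y => \sum_(j <- r | P j) F j y) x = \sum_(j <- r | P j) Ex s (F j) x.
Proof.
move=> nF; elim: r => [|j r IH].
  rewrite big_nil -[RHS](Ex_cst s 0%R x).
  by apply: eq_Ex => y _; rewrite big_nil.
rewrite big_cons -IH; case: ifPn => Pj.
- rewrite -ExD//; last exact: nice_sum.
  by apply: eq_Ex => y _; rewrite big_cons Pj.
- by apply: eq_Ex => y _; rewrite big_cons (negbTE Pj).
Qed.

(** The derandomization step: under a probability measure, a mean below [c] forces a value below
    [c], coordinate after coordinate. *)
Lemma Ex_lt_exists s f x (c : R) : (forall y, 0 <= f y) -> Ex s f x < c%:E ->
  exists2 y, f y < c%:E & forall i, i \notin s -> y i = x i.
Proof.
move=> f0; elim: s x => [|i s IH] x /= fc; first by exists x.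
have [[a ac]|nea] := pselect (exists a, Ex s f (upd x i a) < c%:E).
  have [y fy yx] := IH _ ac; exists y => // j.
  by rewrite inE negb_or => /andP[ji js]; rewrite yx// /upd (negbTE ji).
exfalso; move: fc; apply/negP; rewrite -leNgt.
(* The comparison with the constant [c] needs [c] nonnegative; otherwise nonnegativity of the
   integral already concludes. *)
have [c0|c0] := leP c 0%R.
  by apply: (@le_trans _ _ 0); rewrite ?lee_fin// integral_ge0// => a _; exact: Ex_ge0.
rewrite -[leLHS]integral_gauss_cst.
apply: ge0_le_integral_nonmeas => a; first by rewrite lee_fin ltW.
by rewrite leNgt; apply/negP => ac; apply: nea; exists a.
Qed.

(* Constants are preserved, so only the innermost coordinates matter. *)
Lemma Ex_inner s t f (c : R) x : nice f -> uniq t -> uniq s -> {subset t <= s} ->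
  (forall y, Ex t f y = c%:E) -> Ex s f x = c%:E.
Proof.
move=> nf ut us ts Ec.
rewrite (@Ex_perm _ ([seq i <- s | i \notin t] ++ t))//.
  rewrite Ex_cat -(Ex_cst [seq i <- s | i \notin t] c x); apply: eq_Ex => y _; exact: Ec.
apply: uniq_perm => //.
  rewrite cat_uniq filter_uniq//= ut andbT; apply/hasPn => i it.
  by rewrite mem_filter it.
move=> i; rewrite mem_cat mem_filter; case: (boolP (i \in t)) => [/ts->//|_]; by rewrite orbF.
Qed.

End Expectation.

(** * Measurability of real and complex functions of the coordinates *)

Section ComplexMeasurability.
Variables (R : realType) (I : eqType).
Implicit Types (f g : (I -> R) -> R) (u v : (I -> R) -> R[i]).

Definition rmeas f := forall d (T : measurableType d) (h : I -> T -> R),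
  (forall i, measurable_fun setT (h i)) ->
  measurable_fun setT (fun t => f (fun i => h i t)).

Lemma rmeas_cst c : rmeas (fun=> c).
Proof. by move=> d T h mh; exact: measurable_cst. Qed.

Lemma rmeas_coord i : rmeas (fun x => x i).
Proof. by move=> d T h mh; exact: mh. Qed.

Lemma rmeasD f g : rmeas f -> rmeas g -> rmeas (fun x => f x + g x).
Proof. by move=> mf mg d T h mh; apply: measurable_funD; [exact: mf|exact: mg]. Qed.

Lemma rmeasM f g : rmeas f -> rmeas g -> rmeas (fun x => f x * g x).
Proof. by move=> mf mg d T h mh; apply: measurable_funM; [exact: mf|exact: mg]. Qed.

Lemma rmeasB f g : rmeas f -> rmeas g -> rmeas (fun x => f x - g x).
Proof. by move=> mf mg d T h mh; apply: measurable_funB; [exact: mf|exact: mg]. Qed.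

Lemma rmeas_sum (J : Type) (r : seq J) (F : J -> (I -> R) -> R) :
  (forall j, rmeas (F j)) -> rmeas (fun x => \sum_(j <- r) F j x).
Proof.
move=> mF; elim: r => [|j r IH] d T h mh.
  by under eq_fun do rewrite big_nil; exact: measurable_cst.
under eq_fun do rewrite big_cons.
by apply: measurable_funD; [exact: mF|exact: IH].
Qed.

Lemma nice_expR f : rmeas f -> nice (fun x => (expR (f x))%:E).
Proof.
move=> mf; split=> [x|d T h mh]; first by rewrite lee_fin expR_ge0.
by apply/measurable_EFinP/measurableT_comp => //; exact: mf.
Qed.

Definition cmeas u := rmeas (fun x => complex.Re (u x)) /\ rmeas (fun x => complex.Im (u x)).

Lemma cmeas_cst c : cmeas (fun=> c).
Proof. by split; exact: rmeas_cst. Qed.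

Lemma cmeasD u v : cmeas u -> cmeas v -> cmeas (fun x => u x + v x).
Proof.
move=> [ur ui] [vr vi]; split => d T h mh.
  rewrite (_ : (fun _ => _) = fun t => complex.Re (u (h ^~ t)) + complex.Re (v (h ^~ t))).
    exact: (rmeasD ur vr).
  by apply/funext => t; case: (u _) => ? ?; case: (v _).
rewrite (_ : (fun _ => _) = fun t => complex.Im (u (h ^~ t)) + complex.Im (v (h ^~ t))).
  exact: (rmeasD ui vi).
by apply/funext => t; case: (u _) => ? ?; case: (v _).
Qed.

Lemma cmeasZ c u : cmeas u -> cmeas (fun x => c * u x).
Proof.
case: c => a b [ur ui]; split => d T h mh.
  rewrite (_ : (fun _ => _) = fun t => a * complex.Re (u (h ^~ t)) - b * complex.Im (u (h ^~ t))).
    exact: (rmeasB (rmeasM (rmeas_cst a) ur) (rmeasM (rmeas_cst b) ui)).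
  by apply/funext => t; case: (u _).
rewrite (_ : (fun _ => _) = fun t => a * complex.Im (u (h ^~ t)) + b * complex.Re (u (h ^~ t))).
  exact: (rmeasD (rmeasM (rmeas_cst a) ui) (rmeasM (rmeas_cst b) ur)).
by apply/funext => t; case: (u _).
Qed.

Lemma cmeas_sum (J : Type) (r : seq J) (F : J -> (I -> R) -> R[i]) :
  (forall j, cmeas (F j)) -> cmeas (fun x => \sum_(j <- r) F j x).
Proof.
move=> mF; elim: r => [|j r IH].
  by under eq_fun do rewrite big_nil; exact: cmeas_cst.
by under eq_fun do rewrite big_cons; exact: cmeasD.
Qed.

Lemma rmeas_sqmod u : cmeas u -> rmeas (fun x => sqmod (u x)).
Proof. by move=> [ur ui]; exact: (rmeasD (rmeasM ur ur) (rmeasM ui ui)). Qed.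

End ComplexMeasurability.

(** * Quadratic forms in Gaussian blocks *)

Section GaussianBlocks.
Variables (R : realType) (B : eqType).
Local Notation env := (B * nat * bool -> R).
Implicit Types (x y : env) (L : seq (R[i] * B)) (b : B) (ts : seq nat).
Local Open Scope complex_scope.

Lemma sqmod_ge0 (z : R[i]) : 0 <= sqmod z.
Proof. by rewrite addr_ge0// sqr_ge0. Qed.

Lemma sqmodM (z w : R[i]) : sqmod (z * w) = sqmod z * sqmod w.
Proof. by case: z w => a b [c d]; rewrite /sqmod/=; ring. Qed.

Lemma sqmod_real (a : R) : sqmod a%:C = a ^+ 2.
Proof. by rewrite /sqmod/= expr0n addr0. Qed.

(** A block is an i.i.d. CN(0,1) word; the boolean selects the real or the imaginary part. When its
    blocks are distinct, [lin L] is a Gaussian word of variance [pw L] per symbol. *)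
Definition letter x b t : R[i] := x (b, t, false) +i* x (b, t, true).
Definition lin L x t : R[i] := \sum_(p <- L) p.1 * letter x p.2 t.
Definition pw L : R := \sum_(p <- L) sqmod p.1.
Definition coords b ts : seq (B * nat * bool) :=
  flatten [seq [:: (b, t, false); (b, t, true)] | t <- ts].
Definition coordsL (bs : seq B) ts := flatten [seq coords b ts | b <- bs].

Lemma pw_ge0 L : 0 <= pw L.
Proof. by apply: sumr_ge0 => p _; exact: sqmod_ge0. Qed.

Lemma mem_coords b ts b' t c : ((b', t, c) \in coords b ts) = (b' == b) && (t \in ts).
Proof.
elim: ts => [|s ts IH]; first by rewrite andbF.
rewrite /coords/= !inE -/(coords b ts) IH !xpair_eqE.
by case: (b' == b); case: (t == s); case: (c) => //=; case: (t \in ts).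
Qed.

Lemma mem_coordsL bs ts b t c : ((b, t, c) \in coordsL bs ts) = (b \in bs) && (t \in ts).
Proof.
elim: bs => [|b' bs IH] //.
by rewrite /coordsL/= mem_cat mem_coords -/(coordsL bs ts) IH inE andb_orl.
Qed.

Lemma uniq_coords b ts : uniq ts -> uniq (coords b ts).
Proof.
elim: ts => //= t ts IH /andP[tts uts]; rewrite /coords/= -/(coords b ts) IH//.
by rewrite !inE !mem_coords (negbTE tts) !xpair_eqE/= !andbF.
Qed.

Lemma uniq_coordsL bs ts : uniq bs -> uniq ts -> uniq (coordsL bs ts).
Proof.
move=> + uts; elim: bs => //= b bs IH /andP[bbs ubs].
rewrite /coordsL/= cat_uniq uniq_coords// -/(coordsL bs ts) IH// andbT.
apply/hasPn => -[[b' t] c]; rewrite mem_coordsL => /andP[b'bs _].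
by apply/negP; rewrite mem_coords => /andP[/eqP b'b _]; move: bbs; rewrite -b'b b'bs.
Qed.

Lemma eq_letter x y b t : (forall c, y (b, t, c) = x (b, t, c)) -> letter y b t = letter x b t.
Proof. by move=> yx; rewrite /letter !yx. Qed.

Lemma eq_lin L x y t : (forall p c, p \in L -> y (p.2, t, c) = x (p.2, t, c)) ->
  lin L y t = lin L x t.
Proof.
move=> yx; apply: eq_big_seq => p pL; congr (_ * _); apply: eq_letter => c; exact: yx.
Qed.

Lemma cmeas_letter b t : cmeas (fun x => letter x b t).
Proof. by split; exact: rmeas_coord. Qed.

Lemma cmeas_lin L t : cmeas (fun x => lin L x t).
Proof. by apply: cmeas_sum => p; apply: cmeasZ; exact: cmeas_letter. Qed.

Lemma measurable_gauss_quad (k b : R) :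
  measurable_fun [set: measurableTypeR R] (fun a => (expR (- (k * a ^+ 2 + 2 * b * a)))%:E).
Proof.
apply/measurable_EFinP/measurableT_comp => //.
by apply: measurable_funN; apply: measurable_funD; apply: measurable_funM.
Qed.

(** The exponent separates into a quadratic in the real part and one in the imaginary part of the
    letter; the two inverse square roots multiply to [1 / (1 + l * sqmod h)]. *)
Lemma gauss_letter (l : R) (h r : R[i]) b t x : 0 < 1 + l * sqmod h ->
  (Ex [:: (b, t, false); (b, t, true)]
    (fun y => (expR (- (l * sqmod (r + h * letter y b t))))%:E) x =
  ((1 + l * sqmod h)^-1 * expR (- (l / (1 + l * sqmod h) * sqmod r)))%:E)%E.
Proof.
move=> k0.
have k1 : -1 < l * sqmod h by lra.
(* [al] and [be] are the real and imaginary parts of [r] times the conjugate of [h], so their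
   squares add up to [sqmod r * sqmod h]. *)
pose al := complex.Re r * complex.Re h + complex.Im r * complex.Im h.
pose be := complex.Im r * complex.Re h - complex.Re r * complex.Im h.
have E (a c : R) : - (l * sqmod (r + h * (a +i* c))) =
   - (l * sqmod r) - (l * sqmod h * a ^+ 2 + 2 * (l * al) * a)
    - (l * sqmod h * c ^+ 2 + 2 * (l * be) * c).
  by rewrite /al /be; case: (r) (h) => ? ? [? ?]; rewrite /sqmod/=; ring.
pose S := (Num.sqrt (1 + l * sqmod h))^-1.
have S0 : 0 <= S by rewrite invr_ge0.
rewrite /=; set P := normal_prob _ _.
transitivity (\int[P]_a
    ((expR (- (l * sqmod r)) * (S * expR ((l * be) ^+ 2 / (1 + l * sqmod h))))%:E *
    (expR (- (l * sqmod h * a ^+ 2 + 2 * (l * al) * a)))%:E))%E.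
  apply: eq_integral => a _.
  transitivity (\int[P]_c
     ((expR (- (l * sqmod r)) * expR (- (l * sqmod h * a ^+ 2 + 2 * (l * al) * a)))%:E
     * (expR (- (l * sqmod h * c ^+ 2 + 2 * (l * be) * c)))%:E))%E.
    apply: eq_integral => c _.
    have -> : letter (upd (upd x (b, t, false) a) (b, t, true) c) b t = a +i* c.
      by rewrite /letter /upd !xpair_eqE !eqxx.
    by rewrite E -EFinM -!expRD.
  rewrite ge0_integralZl//; last exact: measurable_gauss_quad.
  rewrite integral_gauss_quad// -!EFinM -/S; congr (_%:E).
  by rewrite -[LHS]mulrA -[RHS]mulrA; congr (_ * _); rewrite mulrC.
rewrite ge0_integralZl//;
  last 2 first.
- exact: measurable_gauss_quad.
- by rewrite lee_fin !mulr_ge0// expR_ge0.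
rewrite integral_gauss_quad// -!EFinM -/S; congr (_%:E).
have SS : S * S = (1 + l * sqmod h)^-1.
  by rewrite -invfM -expr2 sqr_sqrtr// ltW.
rewrite [LHS](_ : _ = S * S * (expR (- (l * sqmod r)) * expR ((l * be) ^+ 2 / (1 + l * sqmod h)) *
   expR ((l * al) ^+ 2 / (1 + l * sqmod h)))); last by ring.
rewrite SS -!expRD; congr (_ * expR _).
have ab : al ^+ 2 + be ^+ 2 = sqmod r * sqmod h.
  by rewrite /al /be; case: (r) (h) => ? ? [? ?]; rewrite /sqmod/=; ring.
have -> : (l * be) ^+ 2 = l ^+ 2 * (sqmod r * sqmod h) - (l * al) ^+ 2 by rewrite -ab; ring.
field; by rewrite gt_eqF.
Qed.

Definition nrm ts (u : nat -> R[i]) : R := \sum_(t <- ts) sqmod (u t).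

Lemma rmeas_nrm ts (u : env -> nat -> R[i]) : (forall t, cmeas (u ^~ t)) ->
  rmeas (fun x => nrm ts (u x)).
Proof. by move=> mu; apply: rmeas_sum => t; apply: rmeas_sqmod; exact: mu. Qed.

Lemma nice_gauss (l : R) ts (u : env -> nat -> R[i]) : (forall t, cmeas (u ^~ t)) ->
  nice (fun y => (expR (- (l * nrm ts (u y))))%:E).
Proof.
move=> mu; apply: nice_expR.
rewrite (_ : (fun _ => _) = fun y => (- l) * nrm ts (u y)).
  by apply: rmeasM; [exact: rmeas_cst|exact: rmeas_nrm].
by apply/funext => y; rewrite mulNr.
Qed.

Lemma cmeas_letter_affine (c h : R[i]) b t : cmeas (fun x => c + h * letter x b t).
Proof.
exact: (cmeasD (cmeas_cst _ _) (cmeasZ h (cmeas_letter b t))).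
Qed.

Lemma cmeas_lin_affine (c : R[i]) L t : cmeas (fun x => c + lin L x t).
Proof. exact: (cmeasD (cmeas_cst _ _) (cmeas_lin L t)). Qed.

Lemma gauss_block (l : R) (h : R[i]) (r : nat -> R[i]) b ts x : uniq ts ->
  0 < 1 + l * sqmod h ->
  (Ex (coords b ts)
    (fun y => (expR (- (l * nrm ts (fun t => r t + h * letter y b t)%R)))%:E) x =
  ((1 + l * sqmod h)^-1 ^+ size ts * expR (- (l / (1 + l * sqmod h) * nrm ts r)))%:E)%E.
Proof.
move=> + k0; elim: ts x => [|t ts IH] x.
  by rewrite /= /nrm !big_nil !mulr0 oppr0 expR0 expr0 mulr1.
move=> /andP[tts uts]; rewrite [size _]/=.
rewrite -[coords b (t :: ts)]/([:: (b, t, false); (b, t, true)] ++ coords b ts) Ex_cat.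
pose C := (1 + l * sqmod h)^-1 ^+ size ts * expR (- (l / (1 + l * sqmod h) * nrm ts r)).
have C0 : 0 <= C by rewrite mulr_ge0 ?expR_ge0// exprn_ge0// invr_ge0 ltW.
transitivity (Ex [:: (b, t, false); (b, t, true)]
    (fun y => C%:E * (expR (- (l * sqmod (r t + h * letter y b t))))%:E)%E x).
  apply: eq_Ex => y _.
  transitivity (Ex (coords b ts) (fun z => (expR (- (l * sqmod (r t + h * letter y b t))))%:E *
     (expR (- (l * nrm ts (fun t => r t + h * letter z b t)%R)))%:E)%E y).
    apply: eq_Ex => z zy; rewrite -EFinM -expRD /nrm big_cons; congr (expR _)%:E.
    rewrite (@eq_letter y z) => [|c]; first by rewrite mulrDr opprD.
    by apply: zy; rewrite mem_coords (negbTE tts) andbF.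
  rewrite ExZ ?expR_ge0//.
    by rewrite IH// muleC.
  by apply: nice_gauss => s; exact: cmeas_letter_affine.
rewrite ExZ//; last first.
  rewrite (_ : (fun _ => _) =
      fun y => (expR (- (l * nrm [:: t] (fun s => r s + h * letter y b s)%R)))%:E).
    by apply: nice_gauss => s; exact: cmeas_letter_affine.
  by apply/funext => y; rewrite /nrm big_seq1.
rewrite gauss_letter// -EFinM /C exprS /nrm big_cons (mulrDr _ (sqmod (r t))) opprD expRD.
by congr (_%:E); ring.
Qed.

(** Integrating out power [P] replaces [l] by [l / (1 + l * P)], that is, adds [P] to [1 / l].
    Successive blocks thus add their powers and act like one Gaussian block of power [pw L]. *)
Lemma gauss_blocks (l : R) L (r : nat -> R[i]) ts x : uniq ts -> uniq (unzip2 L) ->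
  0 < 1 + l * pw L ->
  (Ex (coordsL (unzip2 L) ts)
    (fun y => (expR (- (l * nrm ts (fun t => r t + lin L y t)%R)))%:E) x =
  ((1 + l * pw L)^-1 ^+ size ts * expR (- (l / (1 + l * pw L) * nrm ts r)))%:E)%E.
Proof.
move=> uts; elim: L r x => [|[h b] L IH] r x.
  move=> _ _; rewrite /= /pw big_nil mulr0 addr0 invr1 expr1n mulr1 mul1r.
  by congr (expR (- (l * _)))%:E; apply: eq_bigr => t _; rewrite /lin big_nil addr0.
move=> /andP[bL uL].
rewrite {1}/pw big_cons -/(pw L) [(h, b).1]/= => k0.
(* For negative [l], dropping a block only increases the quantity, so positivity passes to the
   tail. *)
have k1 : 0 < 1 + l * pw L.
  have := sqmod_ge0 h; have := pw_ge0 L; have [l0 p0 _|l0 p0 s0] := leP 0 l.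
    by rewrite ltr_wpDr// mulr_ge0.
  apply: (lt_le_trans k0); rewrite lerD2l mulrDr gerDr mulr_le0_ge0//; exact: ltW.
have k2 : 0 < 1 + l / (1 + l * pw L) * sqmod h.
  rewrite [ltRHS](_ : _ = (1 + l * (sqmod h + pw L)) / (1 + l * pw L)) ?divr_gt0//.
  by field; rewrite gt_eqF.
rewrite -[coordsL (unzip2 ((h, b) :: L)) ts]/(coords b ts ++ coordsL (unzip2 L) ts) Ex_cat.
pose C := (1 + l * pw L)^-1 ^+ size ts.
have C0 : 0 <= C by rewrite exprn_ge0// invr_ge0 ltW.
transitivity (Ex (coords b ts) (fun y => C%:E *
   (expR (- (l / (1 + l * pw L) * nrm ts (fun t => r t + h * letter y b t)%R)))%:E)%E x).
  apply: eq_Ex => y _.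
  transitivity (Ex (coordsL (unzip2 L) ts) (fun z =>
    (expR (- (l * nrm ts (fun t => (r t + h * letter y b t) + lin L z t)%R)))%:E) y).
    apply: eq_Ex => z zy; congr (expR (- (l * _)))%:E; apply: eq_big_seq => t tts.
    rewrite /lin big_cons -/(lin L z t) addrA (@eq_letter y z)// => c.
    by apply: zy; rewrite mem_coordsL (negbTE bL).
  by rewrite IH// EFinM.
rewrite ExZ//; last first.
  by apply: nice_gauss => s; exact: cmeas_letter_affine.
rewrite gauss_block// -EFinM /C mulrA -exprMn -invfM.
have E : (1 + l * pw L) * (1 + l / (1 + l * pw L) * sqmod h) = 1 + l * pw ((h, b) :: L).
  rewrite /pw big_cons -/(pw L) /=; field; by rewrite gt_eqF.
have E2 : l / (1 + l * pw L) / (1 + l / (1 + l * pw L) * sqmod h) =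
    l / (1 + l * pw ((h, b) :: L)) by rewrite -E invfM mulrA.
by rewrite E E2.
Qed.

Lemma linD L1 L2 x t : lin (L1 ++ L2) x t = lin L1 x t + lin L2 x t.
Proof. exact: big_cat. Qed.

Lemma pwD L1 L2 : pw (L1 ++ L2) = pw L1 + pw L2.
Proof. exact: big_cat. Qed.

Lemma cmeas_lin2 Q W t : cmeas (fun x => lin Q x t + lin W x t).
Proof. by apply: cmeasD; exact: cmeas_lin. Qed.

(** The Chernoff moment of the normalized energy of a Gaussian word: negative [mu] serves the upper
    tail, positive [mu] the lower tail, and [c] carries the threshold. *)
Lemma Ex_lin (mu c : R) L ts s x : uniq ts -> uniq (unzip2 L) -> uniq s ->
  {subset coordsL (unzip2 L) ts <= s} -> 0 < pw L -> -1 < mu ->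
  (Ex s (fun y => (expR ((size ts)%:R * c - mu / pw L * nrm ts (lin L y)))%:E) x =
  ((expR c / (1 + mu)) ^+ size ts)%:E)%E.
Proof.
move=> uts uL us Ls p0 m1.
apply: (@Ex_inner _ _ _ (coordsL (unzip2 L) ts)) => //.
- apply: nice_expR; apply: rmeasB; first exact: rmeas_cst.
  by apply: rmeasM; [exact: rmeas_cst|apply: rmeas_nrm => t; exact: cmeas_lin].
- exact: uniq_coordsL.
move=> y.
have ml : mu / pw L * pw L = mu by rewrite divfK// gt_eqF.
transitivity (Ex (coordsL (unzip2 L) ts) (fun z => (expR ((size ts)%:R * c))%:E *
   (expR (- (mu / pw L * nrm ts (fun t => 0 + lin L z t)%R)))%:E)%E y).
  apply: eq_Ex => z _; rewrite -EFinM -expRD; congr (expR (_ - _ * _))%:E.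
  by apply: eq_bigr => t _; rewrite add0r.
rewrite ExZ ?expR_ge0//; last first.
  by apply: nice_gauss => t; exact: cmeas_lin_affine.
rewrite gauss_blocks// ml; last lra.
rewrite [nrm ts _]big1 ?mulr0 ?oppr0 ?expR0 ?mulr1 -?EFinM; last first.
  by move=> t _; rewrite /sqmod/= expr0n addr0.
by rewrite (mulrC _ c) expRM_natr exprMn.
Qed.

(* [Q] is the residual of the received word once the correctly decoded blocks are removed and
   [W] the (negated) wrong guess.  Since [W] is independent of [Q], integrating over [W] alone
   cancels the term in [Q]. *)
Lemma Ex_wrong (c v : R) Q W ts s x : uniq ts -> uniq (unzip2 W) -> uniq s ->
  {subset coordsL (unzip2 W) ts <= s} -> (forall b, b \in unzip2 W -> b \notin unzip2 Q) ->
  0 < v ->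
  (Ex s (fun y => (expR ((size ts)%:R * c + (v + pw W)^-1 * nrm ts (lin Q y)
      - v^-1 * nrm ts (fun t => lin Q y t + lin W y t)%R))%:E) x =
  ((expR c * (v / (v + pw W))) ^+ size ts)%:E)%E.
Proof.
move=> uts uW us Ws WQ v0.
have p0 := pw_ge0 W.
apply: (@Ex_inner _ _ _ (coordsL (unzip2 W) ts)) => //.
- apply: nice_expR; apply: rmeasB.
    apply: rmeasD; first exact: rmeas_cst.
    by apply: rmeasM; [exact: rmeas_cst|apply: rmeas_nrm => t; exact: cmeas_lin].
  by apply: rmeasM; [exact: rmeas_cst|apply: rmeas_nrm => t; exact: cmeas_lin2].
- exact: uniq_coordsL.
move=> y.
have lQ z : (forall i, i \notin coordsL (unzip2 W) ts -> z i = y i) ->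
   forall t, lin Q z t = lin Q y t.
  move=> zy t; apply: eq_lin => p d pQ; apply: zy; rewrite mem_coordsL.
  apply/negP => /andP[pW _]; have := WQ _ pW; apply/negP; rewrite negbK.
  by apply/mapP; exists p.
transitivity (Ex (coordsL (unzip2 W) ts) (fun z =>
   (expR ((size ts)%:R * c + (v + pw W)^-1 * nrm ts (lin Q y)))%:E *
   (expR (- (v^-1 * nrm ts (fun t => lin Q y t + lin W z t)%R)))%:E)%E y).
  apply: eq_Ex => z zy.
  have -> : nrm ts (lin Q z) = nrm ts (lin Q y) by apply: eq_bigr => t _; rewrite lQ.
  have -> : nrm ts (fun t => lin Q z t + lin W z t) = nrm ts (fun t => lin Q y t + lin W z t).
    by apply: eq_bigr => t _; rewrite lQ.
  by rewrite -EFinM -expRD.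
rewrite ExZ ?expR_ge0//; last first.
  by apply: nice_gauss => t; exact: cmeas_lin_affine.
have e1 : 1 + v^-1 * pw W = (v + pw W) / v by field; rewrite gt_eqF.
have vp : 0 < v + pw W by lra.
rewrite gauss_blocks//; last by rewrite e1 divr_gt0.
rewrite -EFinM e1 invf_div; congr (_%:E).
have -> : v^-1 * (v / (v + pw W)) = (v + pw W)^-1 by rewrite mulKf// gt_eqF.
rewrite mulrCA -expRD addrK [_ * c]mulrC expRM_natr -exprMn mulrC//.
Qed.

End GaussianBlocks.

(** * Typicality decoding at one receiver *)

Section Receiver.
Variables (R : realType) (B : eqType) (I0 I1 J1 J2 : finType).
Variables (u : I1 -> J1) (bU : I0 * J1 -> B) (bV : I0 * I1 -> B) (bI : I0 * J2 -> B).
Hypotheses (injU : injective bU) (injV : injective bV) (injI : injective bI).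
Hypotheses (disjUV : forall p q, bU p != bV q) (disjUI : forall p q, bU p != bI q)
  (disjVI : forall p q, bV p != bI q).
Variables (gU gV gI : R[i]) (N : seq (R[i] * B)).
Hypotheses (uN : uniq (unzip2 N)).
Hypotheses (NU : forall p, bU p \notin unzip2 N) (NV : forall p, bV p \notin unzip2 N)
  (NI : forall p, bI p \notin unzip2 N).
Variables (n : nat) (dl v : R).
Local Notation env := (B * nat * bool -> R).
Local Notation ts := (index_iota 0 n).
Hypotheses (pwN : pw N = v) (v0 : 0 < v).
Implicit Types (x : env) (e : I0 * I1 * J2) (y : nat -> R[i]) (T : bitseq).

(** Own cloud centre, own satellite and the interferer's cloud centre. The third index ranges over
    public parts only; the interferer's satellite belongs to [N]. *)
Definition signal e : seq (R[i] * B) :=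
  [:: (gU, bU (e.1.1, u e.1.2)); (gV, bV (e.1.1, e.1.2)); (gI, bI (e.1.1, e.2))].

(* An error type is a mask over the blocks of [signal]: [true] marks a wrong block.  A wrong
   [bV] is in every type, since the private block is indexed by the whole message. *)
Definition error_types : seq bitseq :=
  [:: [:: false; true; false]; [:: true; true; false];
      [:: false; true; true]; [:: true; true; true]].

Definition wrong_pw T : R := \sum_(g <- mask T [:: gU; gV; gI]) sqmod g.

(** The first condition asks that the residual look like noise of variance [v]. The lower bounds ask
    that, before the blocks of type [T] are subtracted, it have nearly their power on top. A wrong
    triple passes only if its independent codewords remove this excess energy. *)
Definition test x y e : bool :=
  (nrm ts (fun t => y t - lin (signal e) x t) < n%:R * (v * (1 + dl))) &&
  all (fun T => n%:R * ((v + wrong_pw T) * (1 - dl)) <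
         nrm ts (fun t => y t - lin (mask (map negb T) (signal e)) x t)) error_types.

Lemma pw_mask T e : pw (mask T (signal e)) = wrong_pw T.
Proof.
by rewrite /pw -(big_map fst xpredT (fun g => sqmod g)) map_mask.
Qed.

Lemma lin_mask T L x t : size T = size L ->
  lin L x t = lin (mask T L) x t + lin (mask (map negb T) L) x t.
Proof.
elim: T L => [|[] T IH] [|p L] //=; first by rewrite /lin !big_nil addr0.
all: move=> [sz].
  by rewrite /lin !big_cons -!/(lin _ _ _) (IH L sz) addrA.
by rewrite /lin !big_cons -!/(lin _ _ _) (IH L sz) addrCA.
Qed.

Lemma size_error_type T : T \in error_types -> size T = 3.
Proof. by rewrite !inE => /or4P[] /eqP->. Qed.

Lemma uniq_signal e : uniq (unzip2 (signal e)).
Proof. by rewrite /= !inE !negb_or disjUV disjUI disjVI. Qed.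

Lemma signal_notin e b : b \in unzip2 (signal e) -> b \notin unzip2 N.
Proof. by rewrite /= !inE => /or3P[] /eqP->. Qed.

Variable e0 : I0 * I1 * J2.
Local Notation received x := (lin (signal e0 ++ N) x).

Definition wrong e := e.1 != e0.1.
(** Every block index contains the common message, so a wrong common index makes all three blocks
    wrong whatever the other indices are. *)
Definition error_type e : bitseq :=
  if e.1.1 != e0.1.1 then [:: true; true; true]
  else [:: u e.1.2 != u e0.1.2; true; e.2 != e0.2].

Lemma error_type_in e : error_type e \in error_types.
Proof. by rewrite /error_type; case: ifP => // _; case: (_ == _); case: (_ == _). Qed.

Lemma error_type_known e : mask (map negb (error_type e)) (signal e) =
  mask (map negb (error_type e)) (signal e0).
Proof.
rewrite /error_type; case: eqP => //= E; rewrite !negbK /signal.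
by rewrite E; case: eqP => [->|_]; case: eqP => [->|_].
Qed.

(** The blocks marked wrong differ from all transmitted ones; this gives the independence required
    by [Ex_wrong]. *)
Lemma error_type_wrong e b : wrong e -> b \in unzip2 (mask (error_type e) (signal e)) ->
  b \notin unzip2 (signal e0).
Proof.
rewrite /error_type /wrong; case: e e0 => [[a m] c] [[a' m'] c'] /=.
have dVU p q : bV q != bU p by rewrite eq_sym disjUV.
have dIU p q : bI q != bU p by rewrite eq_sym disjUI.
have dIV p q : bI q != bV p by rewrite eq_sym disjVI.
have E := (inj_eq injU, inj_eq injV, inj_eq injI, xpair_eqE, disjUV, disjUI, disjVI,
  dVU, dIU, dIV).
case: (eqVneq a a') => [->|/negbTE aa'] /= w; last first.
  by rewrite !inE => /or3P[] /eqP->; rewrite !negb_or !E aa'.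
have {w} mm' : (m == m') = false.
  by apply/negbTE; move: w; apply: contra => /eqP->.
case: (eqVneq (u m) (u m')) => /= [_|/negbTE uu]; case: (eqVneq c c') => /= [_|/negbTE cc].
- by rewrite !inE => /eqP->; rewrite !negb_or !E mm' !eqxx.
- by rewrite !inE => /orP[] /eqP->; rewrite !negb_or !E ?mm' ?cc !eqxx.
- by rewrite !inE => /orP[] /eqP->; rewrite !negb_or !E ?mm' ?uu !eqxx.
- by rewrite !inE => /or3P[] /eqP->; rewrite !negb_or !E ?mm' ?uu ?cc !eqxx.
Qed.

Variables (mu1 mu2 : R).
Hypotheses (mu1_0 : 0 <= mu1) (mu1_1 : mu1 < 1) (mu2_0 : 0 <= mu2).

Definition neg_lin (L : seq (R[i] * B)) := [seq (- p.1, p.2) | p <- L].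

Lemma lin_neg L x t : lin (neg_lin L) x t = - lin L x t.
Proof.
rewrite /lin /neg_lin big_map; under eq_bigr do rewrite mulNr.
by rewrite sumrN.
Qed.

Lemma pw_neg L : pw (neg_lin L) = pw L.
Proof.
rewrite /pw /neg_lin big_map; apply: eq_bigr => -[[a b] ?] _.
by rewrite /sqmod/= !sqrrN.
Qed.

Lemma unzip2_neg L : unzip2 (neg_lin L) = unzip2 L.
Proof. by rewrite /neg_lin /unzip2 -map_comp. Qed.

(** The residual once the correctly guessed blocks are subtracted: the true blocks at the wrong
    positions, plus the noise. *)
Definition known_part T := mask T (signal e0) ++ N.

Definition score_noise x : R :=
  n%:R * (- mu1 * (1 + dl)) - (- mu1) / v * nrm ts (lin N x).
Definition score_type T x : R :=
  n%:R * (mu2 * (1 - dl)) - mu2 / pw (known_part T) * nrm ts (lin (known_part T) x).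
Definition score_wrong e x : R :=
  let T := error_type e in
  n%:R * (2 * dl) + (v + pw (neg_lin (mask T (signal e))))^-1 * nrm ts (lin (known_part T) x)
   - v^-1 * nrm ts (fun t => lin (known_part T) x t + lin (neg_lin (mask T (signal e))) x t).

(* One exponential for each way in which [test] can go wrong: atypical noise, an atypical
   residual of the transmitted triple, or the acceptance of a wrong triple. *)
Definition score x : \bar R :=
  ((expR (score_noise x))%:E + \sum_(T <- error_types) (expR (score_type T x))%:E
   + \sum_(e | wrong e) (expR (score_wrong e x))%:E)%E.

Lemma pw_known T : pw (known_part T) = v + wrong_pw T.
Proof. by rewrite /known_part pwD pw_mask pwN addrC. Qed.

Lemma wrong_pw_ge0 T : 0 <= wrong_pw T.
Proof. by apply: sumr_ge0 => g _; exact: sqmod_ge0. Qed.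

Lemma score_ge1 x :
  ~~ test x (received x) e0 || [exists e, wrong e && test x (received x) e] ->
  (1 <= score x)%E.
Proof.
have n0 : 0 <= n%:R :> R by [].
have ee (q : R) : 0 <= q -> (1 <= (expR q)%:E)%E by rewrite lee_fin -expR0 ler_expR.
have e_ge0 (q : R) : (0 <= (expR q)%:E)%E by rewrite lee_fin expR_ge0.
have s1 : (0 <= \sum_(T <- error_types) (expR (score_type T x))%:E)%E by apply: sume_ge0.
have s2 : (0 <= \sum_(e | wrong e) (expR (score_wrong e x))%:E)%E by apply: sume_ge0.
have known T e : T \in error_types ->
    mask (map negb T) (signal e) = mask (map negb T) (signal e0) ->
    nrm ts (fun t => received x t - lin (mask (map negb T) (signal e)) x t) =
    nrm ts (lin (known_part T) x).
  move=> TE ->; apply: eq_bigr => t _; congr sqmod; rewrite !linD (@lin_mask T (signal e0)).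
    by ring.
  by rewrite (size_error_type TE).
case/orP => [|/existsP[e /andP[we]]]; rewrite /test.
  rewrite negb_and => /orP[|/allPn[T TE]]; rewrite -leNgt => H.
  - apply: (@le_trans _ _ (expR (score_noise x))%:E).
      apply: ee; rewrite /score_noise.
      have -> : nrm ts (lin N x) = nrm ts (fun t => received x t - lin (signal e0) x t).
        by apply: eq_bigr => t _; rewrite linD addrAC subrr add0r.
      rewrite -(ler_pM2l (v0)) mulr0; set r := nrm _ _ in H *.
      have -> : v * (n%:R * (- mu1 * (1 + dl)) - - mu1 / v * r) = mu1 * (r - n%:R * (v * (1 + dl))).
        by field; rewrite gt_eqF.
      by rewrite mulr_ge0// subr_ge0.
    by rewrite /score -addeA leeDl// adde_ge0.
  - apply: (@le_trans _ _ (expR (score_type T x))%:E).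
      apply: ee; rewrite /score_type -(known T e0 TE erefl) pw_known.
      have p0 : 0 < v + wrong_pw T by rewrite ltr_wpDr// wrong_pw_ge0.
      rewrite -(ler_pM2l p0) mulr0; set r := nrm _ _ in H *.
      have -> : (v + wrong_pw T) * (n%:R * (mu2 * (1 - dl)) - mu2 / (v + wrong_pw T) * r) =
          mu2 * (n%:R * ((v + wrong_pw T) * (1 - dl)) - r).
        by field; rewrite gt_eqF.
      by rewrite mulr_ge0// subr_ge0.
    rewrite /score addeAC; apply: (@le_trans _ _ (\sum_(T <- error_types) (expR (score_type T x))%:E)%E).
      by rewrite (big_rem T)//= leeDl// sume_ge0.
    by rewrite leeDr// adde_ge0.
move=> /andP[H1 /allP H2].
have TE := error_type_in e; have {H2} := H2 _ TE.
rewrite (known _ _ TE (error_type_known e)) => H2.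
apply: (@le_trans _ _ (expR (score_wrong e x))%:E).
  apply: ee; rewrite /score_wrong pw_neg pw_mask.
  set T := error_type e in TE H1 H2 *.
  have -> : nrm ts (fun t => lin (known_part T) x t + lin (neg_lin (mask T (signal e))) x t) =
     nrm ts (fun t => received x t - lin (signal e) x t).
    apply: eq_bigr => t _; congr sqmod; rewrite lin_neg !linD.
    rewrite (@lin_mask T (signal e0)) ?(size_error_type TE)//.
    rewrite (@lin_mask T (signal e)) ?(size_error_type TE)//.
    by rewrite -(error_type_known e) -/T; ring.
  set r := nrm _ (fun t => _) in H1 *; set q := nrm _ _ in H2 *.
  have p0 : 0 < v + wrong_pw T by rewrite ltr_wpDr// wrong_pw_ge0.
  (* The normalized thresholds [1 + dl] and [1 - dl] differ by [2 * dl], the constant put into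
     [score_wrong]. *)
  have A : v^-1 * r <= n%:R * (1 + dl).
    by rewrite mulrC ler_pdivrMr// -mulrA (mulrC _ v); exact: ltW.
  have C : n%:R * (1 - dl) <= (v + wrong_pw T)^-1 * q.
    by rewrite ler_pdivlMl// mulrCA; exact: ltW.
  lra.
rewrite /score; apply: (@le_trans _ _ (\sum_(e | wrong e) (expR (score_wrong e x))%:E)%E).
  by rewrite (bigD1 e)//= leeDl// sume_ge0.
by rewrite leeDr// adde_ge0.
Qed.

Lemma rmeas_nrm_lin (c k : R) L : rmeas (fun x => c - k * nrm ts (lin L x)).
Proof.
apply: rmeasB; first exact: rmeas_cst.
by apply: rmeasM; [exact: rmeas_cst|apply: rmeas_nrm => t; exact: cmeas_lin].
Qed.

Lemma nice_score_wrong e : nice (fun x => (expR (score_wrong e x))%:E).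
Proof.
apply: nice_expR; apply: rmeasB.
  apply: rmeasD; first exact: rmeas_cst.
  by apply: rmeasM; [exact: rmeas_cst|apply: rmeas_nrm => t; exact: cmeas_lin].
apply: rmeasM; first exact: rmeas_cst.
by apply: rmeas_nrm => t; exact: cmeas_lin2.
Qed.

Lemma nice_score : nice score.
Proof.
apply: niceD; first apply: niceD.
- by apply: nice_expR; exact: rmeas_nrm_lin.
- by apply: nice_sum => T; apply: nice_expR; exact: rmeas_nrm_lin.
- by apply: nice_sum => e; exact: nice_score_wrong.
Qed.

(** Per-symbol expectations of the three kinds of exponentials. In [rate_wrong], the factor
    [v / (v + wrong_pw T)] is 2 to the power minus the capacity at signal-to-noise ratio
    [wrong_pw T / v], so the union bound over wrong triples yields the rate condition of type
    [T]. *)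
Definition rate_noise := expR (- mu1 * (1 + dl)) / (1 + - mu1).
Definition rate_type := expR (mu2 * (1 - dl)) / (1 + mu2).
Definition rate_wrong T := expR (2 * dl) * (v / (v + wrong_pw T)).

Definition receiver_bound := rate_noise ^+ n + \sum_(T <- error_types) rate_type ^+ n
  + \sum_(e | wrong e) rate_wrong (error_type e) ^+ n.

Lemma uniq_known T : uniq (unzip2 (known_part T)).
Proof.
rewrite /known_part /unzip2 map_cat cat_uniq uN andbT map_mask mask_uniq ?uniq_signal//=.
by apply/hasPn => b bN; apply/negP => /mem_mask/signal_notin; rewrite bN.
Qed.

Lemma Ex_score s x : uniq s -> (forall b t c, (t < n)%N -> (b, t, c) \in s) ->
  (Ex s score x = receiver_bound%:E)%E.
Proof.
move=> us sub.
have subL bs : {subset coordsL bs ts <= s}.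
  move=> [[b t] c]; rewrite mem_coordsL mem_index_iota => /andP[_ /andP[_ tn]].
  exact: sub.
have sz : size ts = n by rewrite size_iota subn0.
have uts : uniq ts by exact: iota_uniq.
have n1 : nice (fun x => (expR (score_noise x))%:E).
  by apply: nice_expR; exact: rmeas_nrm_lin.
have n2 T : nice (fun x => (expR (score_type T x))%:E).
  by apply: nice_expR; exact: rmeas_nrm_lin.
have n3 := nice_score_wrong.
rewrite ExD; [|by apply: niceD => //; exact: nice_sum|exact: nice_sum].
rewrite ExD//; last exact: nice_sum.
rewrite !Ex_sum// /receiver_bound !EFinD -!sumEFin.
congr (_ + _ + _)%E.
- have := @Ex_lin R B (- mu1) (- mu1 * (1 + dl)) N ts s x; rewrite sz pwN; apply=> //.
  by rewrite ltrN2.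
- apply: eq_big_seq => T TE.
  have := @Ex_lin R B mu2 (mu2 * (1 - dl)) (known_part T) ts s x; rewrite sz; apply=> //.
  + exact: uniq_known.
  + by rewrite pw_known ltr_wpDr// wrong_pw_ge0.
  + by rewrite (lt_le_trans _ mu2_0)// oppr_lt0.
- apply: eq_bigr => e we; rewrite /rate_wrong -(pw_mask _ e) -[pw (mask _ _)]pw_neg.
  have := @Ex_wrong R B (2 * dl) v (known_part (error_type e))
    (neg_lin (mask (error_type e) (signal e))) ts s x; rewrite sz; apply=> //.
  + by rewrite unzip2_neg /unzip2 map_mask mask_uniq ?uniq_signal.
  + move=> b; rewrite unzip2_neg => bW.
    rewrite /known_part /unzip2 map_cat mem_cat negb_or.
    have -> : b \notin [seq i.2 | i <- N].
      by apply: (@signal_notin e); move: bW; rewrite /unzip2 map_mask; exact: mem_mask.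
    rewrite andbT map_mask; apply: contra (error_type_wrong we bW); exact: mem_mask.
Qed.

Definition nwrong T := #|[set e | wrong e && (error_type e == T)]%SET|.

Lemma sum_rate_wrong (F : bitseq -> R) :
  \sum_(e | wrong e) F (error_type e) = \sum_(T <- error_types) (nwrong T)%:R * F T.
Proof.
rewrite (eq_bigr (fun e => \sum_(T <- error_types | error_type e == T) F T)); last first.
  move=> e _; rewrite -big_filter.
  rewrite (_ : [seq T <- error_types | error_type e == T] = [:: error_type e]) ?big_seq1//.
  by move: (error_type_in e); rewrite !inE => /or4P[] /eqP->.
rewrite (exchange_big_dep xpredT)//=; apply: eq_bigr => T _.
by rewrite sumr_const /nwrong cardsE mulr_natl.
Qed.

Lemma nwrong_private : (nwrong [:: false; true; false] <= #|[set b | u b == u e0.1.2]%SET|)%N.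
Proof.
set A := [set b | _]%SET.
apply: (@leq_trans #|[set (e0.1.1, b, e0.2) | b in A]%SET|); last exact: leq_imset_card.
apply/subset_leq_card/fintype.subsetP => -[[a b] c]; rewrite inE => /andP[_].
rewrite /error_type /=; case: (eqVneq a e0.1.1) => //= ->.
case: (eqVneq (u b) (u e0.1.2)) => //= ub; case: (eqVneq c e0.2) => //= -> _.
by apply/imsetP; exists b; rewrite ?inE ?ub.
Qed.

Lemma nwrong_own : (nwrong [:: true; true; false] <= #|I1|)%N.
Proof.
apply: (@leq_trans #|[set (e0.1.1, b, e0.2) | b in [set: I1]]%SET|); last first.
  by rewrite -cardsT; exact: leq_imset_card.
apply/subset_leq_card/fintype.subsetP => -[[a b] c]; rewrite inE => /andP[_].
rewrite /error_type /=; case: (eqVneq a e0.1.1) => //= ->.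
case: (eqVneq (u b) (u e0.1.2)) => //= ub; case: (eqVneq c e0.2) => //= -> _.
by apply/imsetP; exists b; rewrite ?inE.
Qed.

Lemma nwrong_cross :
  (nwrong [:: false; true; true] <= #|[set b | u b == u e0.1.2]%SET| * #|J2|)%N.
Proof.
set A := [set b | _]%SET.
apply: (@leq_trans #|[set (e0.1.1, p.1, p.2) | p in finset.setX A [set: J2]%SET]%SET|); last first.
  by rewrite (leq_trans (leq_imset_card _ _))// cardsX cardsT.
apply/subset_leq_card/fintype.subsetP => -[[a b] c]; rewrite inE => /andP[_].
rewrite /error_type /=; case: (eqVneq a e0.1.1) => //= ->.
case: (eqVneq (u b) (u e0.1.2)) => //= ub; case: (eqVneq c e0.2) => //= _ _.
by apply/imsetP; exists (b, c); rewrite ?inE ?ub ?eqxx.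
Qed.

Lemma nwrong_all T : (nwrong T <= #|I0| * #|I1| * #|J2|)%N.
Proof. by rewrite -!card_prod; exact: max_card. Qed.

(** For the case of a zero rate, where the matching capacity may vanish and nothing decays: the type
    must then contain no triple at all. The next two lemmas serve the same end. *)
Lemma nwrong_private0 T : head true T = false -> injective u -> nwrong T = 0%N.
Proof.
move=> hT iu; apply: eq_card0 => -[[a b] c]; apply/negbTE/negP.
rewrite !inE /wrong /error_type /= => /andP[+ /eqP TE]; move: hT; rewrite -TE.
case: (eqVneq a e0.1.1) => //= -> /negbFE/eqP/iu ->; by rewrite -surjective_pairing eqxx.
Qed.

Lemma nwrong_own0 : (#|I1| <= 1)%N -> nwrong [:: true; true; false] = 0%N.
Proof.
move=> /card_le1P H; apply: eq_card0 => -[[a b] c]; apply/negbTE/negP.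
rewrite !inE /error_type /= => /andP[_]; case: (eqVneq a e0.1.1) => //= _.
have -> : b = e0.1.2 by apply/eqP; have := H b isT e0.1.2; rewrite !inE => /esym ; rewrite eq_sym.
by rewrite eqxx.
Qed.

Lemma nwrong_all0 T : (#|I0| <= 1)%N -> (#|I1| <= 1)%N -> nwrong T = 0%N.
Proof.
move=> /card_le1P H0 /card_le1P H; apply: eq_card0 => -[[a b] c]; apply/negbTE/negP.
rewrite !inE /wrong /= => /andP[+ _].
have -> : b = e0.1.2 by apply/eqP; have := H b isT e0.1.2; rewrite !inE => /esym ; rewrite eq_sym.
have -> : a = e0.1.1 by apply/eqP; have := H0 a isT e0.1.1; rewrite !inE => /esym ; rewrite eq_sym.
by rewrite -surjective_pairing eqxx.
Qed.

End Receiver.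

(** * The noise expectation as an iterated integral over coordinates *)

Section NoiseExpectation.
Variables (R : realType) (B : eqType) (z1 z2 : B).
Hypothesis z12 : z1 != z2.
Local Open Scope complex_scope.

Definition noise_coords (ts : seq nat) : seq (B * nat * bool) :=
  flatten [seq [:: (z1, t, false); (z1, t, true); (z2, t, false); (z2, t, true)] | t <- ts].
Definition noise_seq (x : B * nat * bool -> R) (ts : seq nat) : seq (R[i] * R[i]) :=
  [seq (letter x z1 t, letter x z2 t) | t <- ts].

Lemma mem_noise_coords ts b t c :
  ((b, t, c) \in noise_coords ts) = ((b == z1) || (b == z2)) && (t \in ts).
Proof.
elim: ts => [|s ts IH]; first by rewrite andbF.
rewrite /noise_coords/= !inE -/(noise_coords ts) IH !xpair_eqE.
by case: (b == z1); case: (b == z2); case: (t == s); case: (c) => //=; case: (t \in ts).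
Qed.

Lemma uniq_noise_coords ts : uniq ts -> uniq (noise_coords ts).
Proof.
elim: ts => //= t ts IH /andP[tts uts]; rewrite /noise_coords/= -/(noise_coords ts) IH//.
by rewrite !inE !mem_noise_coords (negbTE tts) !xpair_eqE/= !(negbTE z12) !andbF.
Qed.

(** [noise_coords] lists the four real variables of each time in the order of [noise_exp], so the
    integrals match level by level. The offset [j] is needed for the induction, since [noise_exp]
    keeps no time index. *)
Lemma noise_expE j k (phi : seq (R[i] * R[i]) -> \bar R) x :
  noise_exp k phi = Ex (noise_coords (iota j k)) (fun y => phi (noise_seq y (iota j k))) x.
Proof.
elim: k j phi x => [|k IH] j phi x; first exact: erefl.
rewrite [iota j k.+1]/= [noise_coords _]/(
  [:: (z1, j, false); (z1, j, true); (z2, j, false); (z2, j, true)] ++ noise_coords (iota j.+1 k)).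
rewrite /=; apply: eq_integral => a _; apply: eq_integral => b _.
apply: eq_integral => c _; apply: eq_integral => d _.
set X := upd _ _ d; etransitivity; first exact: (IH j.+1 _ X).
apply: eq_Ex => y yx.
have z21 : (z2 == z1) = false by rewrite eq_sym (negbTE z12).
have yj z e : y (z, j, e) = X (z, j, e).
  by apply: yx; rewrite mem_noise_coords mem_iota ltnn andbF.
by rewrite /noise_seq /= /letter !yj /X /upd !xpair_eqE !eqxx !(negbTE z12) ?z21.
Qed.

End NoiseExpectation.

(** * Measurability and correctness of the decoder *)

Section FiniteTests.
Context d (Y : measurableType d) (H : finType) (M : eqType).

(** The output depends on finitely many bits, so its fibres are finite unions of finite
    intersections of test sets and their complements. *)
Lemma measurable_finite_tests (Q : H -> Y -> bool) (F : {ffun H -> bool} -> M) (m : M) :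
  (forall e, measurable [set y | Q e y]) ->
  measurable [set y | F [ffun e => Q e y] = m].
Proof.
move=> mQ.
rewrite (_ : [set y | _] = \bigcup_(f in [set f | F f = m])
    \bigcap_(e in [set: H]) [set y | Q e y = f e]).
  apply: fin_bigcup_measurable => [|f _]; first exact: finite_finset.
  apply: fin_bigcap_measurable => [|e _]; first exact: finite_finset.
  case: (f e); first exact: mQ.
  rewrite (_ : [set y | _] = ~` [set y | Q e y]); first exact: measurableC.
  by apply/seteqP; split => y /=; case: (Q e y).
apply/seteqP; split => y /=.
  by move=> Fm; exists [ffun e => Q e y] => // e _ /=; rewrite ffunE.
move=> [f Ff Qf]; rewrite -Ff; congr F; apply/ffunP => e; rewrite ffunE; exact: Qf.
Qed.

End FiniteTests.

Section TestExtensionality.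
Variables (R : realType) (B : eqType) (I0 I1 J1 J2 : finType).
Variables (u : I1 -> J1) (bU : I0 * J1 -> B) (bV : I0 * I1 -> B) (bI : I0 * J2 -> B).
Variables (gU gV gI : R[i]) (n : nat) (dl v : R).

Lemma eq_nrm (y y' : nat -> R[i]) : (forall t, (t < n)%N -> y t = y' t) ->
  nrm (index_iota 0 n) y = nrm (index_iota 0 n) y'.
Proof.
move=> yy; apply: eq_big_seq => t; rewrite mem_index_iota => /andP[_ tn].
by rewrite yy.
Qed.

(** The test reads only the codewords of its triple, so a decoder built from the codebook is
    unaffected by the noise coordinates. *)
Lemma eq_test (x x' : B * nat * bool -> R) (y y' : nat -> R[i]) e :
  (forall t, (t < n)%N -> y t = y' t) ->
  (forall b t c, (t < n)%N -> b \in unzip2 (signal u bU bV bI gU gV gI e) ->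
     x (b, t, c) = x' (b, t, c)) ->
  test u bU bV bI gU gV gI n dl v x y e = test u bU bV bI gU gV gI n dl v x' y' e.
Proof.
move=> yy xx; have H T : nrm (index_iota 0 n)
     (fun t => y t - lin (mask T (signal u bU bV bI gU gV gI e)) x t) =
   nrm (index_iota 0 n) (fun t => y' t - lin (mask T (signal u bU bV bI gU gV gI e)) x' t).
  apply: eq_nrm => t tn; rewrite yy//; congr (_ - _); apply: eq_lin => p c /mem_mask pS.
  by apply: xx => //; apply/mapP; exists p.
(* The all-true mask recovers the full signal of the first condition. *)
rewrite /test; congr (_ && _); first by have := H (nseq 3 true); rewrite [mask _ _]/= => ->.
by apply: eq_all => T; rewrite H.
Qed.

End TestExtensionality.

Section Decoder.
Variables (R : realType) (B : eqType) (I0 I1 J1 J2 : finType).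
Variables (u : I1 -> J1) (bU : I0 * J1 -> B) (bV : I0 * I1 -> B) (bI : I0 * J2 -> B).
Variables (gU gV gI : R[i]) (n : nat) (dl v : R) (x : B * nat * bool -> R).
Variable dflt : I0 * I1.
Local Notation tst := (test u bU bV bI gU gV gI n dl v x).

Definition decode (y : n.-tuple R[i]) : I0 * I1 :=
  if [pick e | tst (nth 0 y) e] is Some e then e.1 else dflt.

(** Accepted triples may still differ in the interferer's index; the output discards it, and [wrong]
    ignores it. *)
Lemma decode_correct (y : n.-tuple R[i]) e0 : tst (nth 0 y) e0 ->
  ~~ [exists e, wrong e0 e && tst (nth 0 y) e] -> decode y = e0.1.
Proof.
move=> t0 /existsPn nw; rewrite /decode; case: pickP => [e te|/(_ e0)]; last by rewrite t0.
by apply/eqP; move: (nw e); rewrite te andbT negbK.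
Qed.

Lemma measurable_nrm_received (c : nat -> R[i]) :
  measurable_fun [set: n.-tuple (R * R)]
    (fun y => nrm (index_iota 0 n) (fun t => nth 0 (of_pairs y) t - c t)).
Proof.
rewrite /nrm.
have E (y : n.-tuple (R * R)) :
    \sum_(t <- index_iota 0 n) sqmod (nth 0 (of_pairs y) t - c t) =
    \sum_(t < n) (((tnth y t).1 - complex.Re (c t)) ^+ 2 + ((tnth y t).2 - complex.Im (c t)) ^+ 2).
  rewrite big_mkord; apply: eq_bigr => t _.
  by rewrite -tnth_nth tnth_mktuple; case: (c t).
rewrite (_ : (fun _ => _) = fun y : n.-tuple (R * R) => \sum_(t < n)
   (((tnth y t).1 - complex.Re (c t)) ^+ 2 + ((tnth y t).2 - complex.Im (c t)) ^+ 2)); last first.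
  by apply/funext => y; rewrite E.
apply: measurable_sum => t; apply: measurable_funD; apply: measurable_funX;
  apply: measurable_funB => //.
- by apply: (measurableT_comp measurable_fst); exact: measurable_tnth.
- by apply: (measurableT_comp measurable_snd); exact: measurable_tnth.
Qed.

Lemma measurable_decode m : measurable [set y : n.-tuple (R * R) | decode (of_pairs y) = m].
Proof.
pose Q e (y : n.-tuple (R * R)) := tst (nth 0 (of_pairs y)) e.
pose F (f : {ffun I0 * I1 * J2 -> bool}) := if [pick e | f e] is Some e then e.1 else dflt.
rewrite (_ : [set y | _] = [set y | F [ffun e => Q e y] = m]); last first.
  apply/funext => y /=; congr (_ = _); rewrite /decode /F.
  by rewrite (eq_pick (ffunE (Q^~ y))).
apply: measurable_finite_tests => e.
have mt : measurable_fun [set: n.-tuple (R * R)] (fun y => tst (nth 0 (of_pairs y)) e).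
  have ml (c : nat -> R[i]) k : measurable_fun [set: n.-tuple (R * R)] (fun y =>
      k < nrm (index_iota 0 n) (fun t => nth 0 (of_pairs y) t - c t)).
    by apply: measurable_fun_ltr => //; exact: measurable_nrm_received.
  apply: measurable_and.
    by apply: measurable_fun_ltr => //; exact: measurable_nrm_received.
  rewrite /=; apply: measurable_and; first exact: ml.
  apply: measurable_and; first exact: ml.
  apply: measurable_and; first exact: ml.
  by apply: measurable_and; first exact: ml.
by have := mt measurableT [set true] Logic.I; rewrite setTI.
Qed.

End Decoder.

(** * The superposition code *)

Section Scheme.
Variables (R : realType) (h11 h12 h21 h22 : R[i]) (n : nat) (r0 r1 r2 : R).
Local Notation M0 := (nmsg n r0).
Local Notation M1 := (nmsg n r1).
Local Notation M2 := (nmsg n r2).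
Hypotheses (M0_gt0 : (0 < M0)%N) (M1_gt0 : (0 < M1)%N) (M2_gt0 : (0 < M2)%N).
Variables (C1 C2 : nat) (u1 : 'I_M1 -> 'I_C1) (u2 : 'I_M2 -> 'I_C2).
Variables (th q1 q2 dl mu1 mu2 : R).
Hypotheses (th0 : 0 < th) (q1_ge0 : 0 <= q1) (q1_le1 : q1 <= 1)
  (q2_ge0 : 0 <= q2) (q2_le1 : q2 <= 1).
Hypotheses (mu1_ge0 : 0 <= mu1) (mu1_lt1 : mu1 < 1) (mu2_ge0 : 0 <= mu2).
Local Open Scope complex_scope.

(** One summand per codebook and one for the two noises: distinct codewords, and the noises, are
    independent by construction. *)
Definition block : finType :=
  (('I_M0 * 'I_C1 + 'I_M0 * 'I_M1) + ('I_M0 * 'I_C2 + 'I_M0 * 'I_M2) + bool)%type.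
Definition bU1 (p : 'I_M0 * 'I_C1) : block := inl (inl (inl p)).
Definition bV1 (p : 'I_M0 * 'I_M1) : block := inl (inl (inr p)).
Definition bU2 (p : 'I_M0 * 'I_C2) : block := inl (inr (inl p)).
Definition bV2 (p : 'I_M0 * 'I_M2) : block := inl (inr (inr p)).
Definition bZ1 : block := inr false.
Definition bZ2 : block := inr true.
Local Notation env := (block * nat * bool -> R).
Local Notation ts := (index_iota 0 n).

Definition amp (s : R) : R[i] := (Num.sqrt s)%:C.

Lemma sqmod_amp s : 0 <= s -> sqmod (amp s) = s.
Proof. by move=> s0; rewrite sqmod_real sqr_sqrtr. Qed.

(** [th] is the total power of each user, [q1] and [q2] the shares given to the satellites. *)
Definition aU1 := amp (th * (1 - q1)).
Definition aV1 := amp (th * q1).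
Definition aU2 := amp (th * (1 - q2)).
Definition aV2 := amp (th * q2).

Definition word1 m0 m1 : seq (R[i] * block) := [:: (aU1, bU1 (m0, u1 m1)); (aV1, bV1 (m0, m1))].
Definition word2 m0 m2 : seq (R[i] * block) := [:: (aU2, bU2 (m0, u2 m2)); (aV2, bV2 (m0, m2))].
Definition noise1 m0 m2 : seq (R[i] * block) := [:: (h12 * aV2, bV2 (m0, m2)); (1, bZ1)].
Definition noise2 m0 m1 : seq (R[i] * block) := [:: (h21 * aV1, bV1 (m0, m1)); (1, bZ2)].
Definition var1 := sqmod h12 * (th * q2) + 1.
Definition var2 := sqmod h21 * (th * q1) + 1.

Lemma pw_cons2 (a b : R[i]) (b1 b2 : block) : pw [:: (a, b1); (b, b2)] = sqmod a + sqmod b.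
Proof. by rewrite /pw !big_cons big_nil addr0. Qed.

Lemma pw_word1 m0 m1 : pw (word1 m0 m1) = th.
Proof.
rewrite pw_cons2 !sqmod_amp ?mulr_ge0 ?subr_ge0// ?(ltW th0)//; ring.
Qed.

Lemma pw_word2 m0 m2 : pw (word2 m0 m2) = th.
Proof.
rewrite pw_cons2 !sqmod_amp ?mulr_ge0 ?subr_ge0// ?(ltW th0)//; ring.
Qed.

Lemma sqmod1 : sqmod (1 : R[i]) = 1.
Proof. by rewrite /sqmod/= expr0n expr1n addr0. Qed.

Lemma pw_noise1 m0 m2 : pw (noise1 m0 m2) = var1.
Proof. by rewrite pw_cons2 sqmodM sqmod1 sqmod_amp// mulr_ge0// ltW. Qed.

Lemma pw_noise2 m0 m1 : pw (noise2 m0 m1) = var2.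
Proof. by rewrite pw_cons2 sqmodM sqmod1 sqmod_amp// mulr_ge0// ltW. Qed.

Lemma var1_gt0 : 0 < var1.
Proof. by rewrite ltr_wpDl// mulr_ge0 ?sqmod_ge0// mulr_ge0// ltW. Qed.

Lemma var2_gt0 : 0 < var2.
Proof. by rewrite ltr_wpDl// mulr_ge0 ?sqmod_ge0// mulr_ge0// ltW. Qed.

Local Notation test1 := (test u1 bU1 bV1 bU2 (h11 * aU1) (h11 * aV1) (h12 * aU2) n dl var1).
Local Notation test2 := (test u2 bU2 bV2 bU1 (h22 * aU2) (h22 * aV2) (h21 * aU1) n dl var2).
Local Notation signal1 := (signal u1 bU1 bV1 bU2 (h11 * aU1) (h11 * aV1) (h12 * aU2)).
Local Notation signal2 := (signal u2 bU2 bV2 bU1 (h22 * aU2) (h22 * aV2) (h21 * aU1)).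

(* A codeword that exceeds the power budget is replaced by zero, so that the power constraint
   holds for every codebook; the excess is charged to the error probability. *)
Definition clip (L : seq (R[i] * block)) (y : env) (t : nat) : R[i] :=
  if nrm ts (lin L y) <= n%:R then lin L y t else 0.

Lemma average_power a b (E : 'I_a -> 'I_b -> 'I_n -> R[i]) :
  (forall i j, \sum_(t < n) sqmod (E i j t) <= n%:R) ->
  n%:R^-1 * \sum_(t < n) ((a * b)%:R^-1 * \sum_(i < a) \sum_(j < b) sqmod (E i j t)) <= 1.
Proof.
move=> hE.
rewrite -mulr_sumr exchange_big/=.
under eq_bigr do rewrite exchange_big/=.
have S : \sum_(i < a) \sum_(j < b) \sum_(t < n) sqmod (E i j t) <= (a * b)%:R * n%:R.
  apply: (@le_trans _ _ (\sum_(i < a) \sum_(j < b) n%:R)).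
    by apply: ler_sum => i _; apply: ler_sum => j _.
  by rewrite !sumr_const !card_ord mulr_natl -mulrnA mulnC.
(* An inequality rather than an equality, so that block length zero is covered: the inverse of zero
   is zero. *)
have V (k : nat) : k%:R^-1 * k%:R <= 1 :> R.
  by have [->|k0] := eqVneq k 0%N; rewrite ?mulr0// mulVf// pnatr_eq0.
apply: (@le_trans _ _ (n%:R^-1 * n%:R)) => //.
rewrite ler_wpM2l// (@le_trans _ _ ((a * b)%:R^-1 * ((a * b)%:R * n%:R)))//.
  by rewrite ler_wpM2l.
by rewrite mulrA ler_piMl.
Qed.

Lemma clip_power L y : \sum_(t < n) sqmod (clip L y t) <= n%:R.
Proof.
have [H|/negbTE H] := boolP (nrm ts (lin L y) <= n%:R).
  by under eq_bigr do rewrite /clip H; move: H; rewrite /nrm big_mkord.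
by rewrite big1// => t _; rewrite /clip H /sqmod/= expr0n addr0.
Qed.

Definition scheme_code (y : env) : Defs.code n r0 r1 r2 :=
  @Code R n r0 r1 r2 (fun m0 m1 t => clip (word1 m0 m1) y t) (fun m0 m2 t => clip (word2 m0 m2) y t)
    (decode u1 bU1 bV1 bU2 (h11 * aU1) (h11 * aV1) (h12 * aU2) dl var1 y
      (Ordinal M0_gt0, Ordinal M1_gt0))
    (decode u2 bU2 bV2 bU1 (h22 * aU2) (h22 * aV2) (h21 * aU1) dl var2 y
      (Ordinal M0_gt0, Ordinal M2_gt0))
    (@average_power _ _ (fun m0 m1 t => clip (word1 m0 m1) y t) (fun m0 m1 => clip_power _ _))
    (@average_power _ _ (fun m0 m2 t => clip (word2 m0 m2) y t) (fun m0 m2 => clip_power _ _))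
    (fun m => @measurable_decode _ _ _ _ _ _ _ _ _ _ _ _ _ n _ _ _ _ m)
    (fun m => @measurable_decode _ _ _ _ _ _ _ _ _ _ _ _ _ n _ _ _ _ m).

Definition score_power (L : seq (R[i] * block)) (x : env) : R :=
  n%:R * (- mu1 / th) - (- mu1) / th * nrm ts (lin L x).

Definition scoreRx1 m0 m1 m2 := score u1 bU1 bV1 bU2 (h11 * aU1) (h11 * aV1) (h12 * aU2)
  (noise1 m0 m2) n dl var1 (m0, m1, u2 m2) mu1 mu2.
Definition scoreRx2 m0 m1 m2 := score u2 bU2 bV2 bU1 (h22 * aU2) (h22 * aV2) (h21 * aU1)
  (noise2 m0 m1) n dl var2 (m0, m2, u1 m1) mu1 mu2.

Definition score_total m0 m1 m2 (x : env) : \bar R :=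
  (scoreRx1 m0 m1 m2 x + scoreRx2 m0 m1 m2 x +
   ((expR (score_power (word1 m0 m1) x))%:E + (expR (score_power (word2 m0 m2) x))%:E))%E.

Lemma nice_score_power L : nice (fun x => (expR (score_power L x))%:E).
Proof. by apply: nice_expR; exact: rmeas_nrm_lin. Qed.

Lemma nice_score_total m0 m1 m2 : nice (score_total m0 m1 m2).
Proof.
by apply: niceD; apply: niceD; [exact: nice_score|exact: nice_score|exact: nice_score_power|
  exact: nice_score_power].
Qed.

Lemma score_power_ge1 L x : n%:R < nrm ts (lin L x) -> (1 <= (expR (score_power L x))%:E)%E.
Proof.
move=> H; rewrite lee_fin -expR0 ler_expR /score_power.
have -> : n%:R * (- mu1 / th) - - mu1 / th * nrm ts (lin L x) = mu1 / th * (nrm ts (lin L x) - n%:R).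
  by ring.
by rewrite mulr_ge0 ?divr_ge0 ?subr_ge0// ltW.
Qed.

Lemma receivedE1 m0 m1 m2 x t : lin (signal1 (m0, m1, u2 m2) ++ noise1 m0 m2) x t =
  h11 * lin (word1 m0 m1) x t + h12 * lin (word2 m0 m2) x t + letter x bZ1 t.
Proof. by rewrite /lin !big_cons !big_nil /=; ring. Qed.

Lemma receivedE2 m0 m1 m2 x t : lin (signal2 (m0, m2, u1 m1) ++ noise2 m0 m1) x t =
  h21 * lin (word1 m0 m1) x t + h22 * lin (word2 m0 m2) x t + letter x bZ2 t.
Proof. by rewrite /lin !big_cons !big_nil /=; ring. Qed.

Local Notation ncoords := (noise_coords bZ1 bZ2 ts).

Lemma indicator_le (b : bool) (S : \bar R) : (0 <= S)%E -> (b -> 1 <= S)%E ->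
  ((if b then 1 else 0)%:E <= S)%E.
Proof. by move=> S0; case: b => // H; exact: H. Qed.

Lemma le_sum4 (a b c d : \bar R) : (0 <= a -> 0 <= b -> 0 <= c -> 0 <= d ->
  [/\ a <= a + b + (c + d), b <= a + b + (c + d), c <= a + b + (c + d) & d <= a + b + (c + d)])%E.
Proof.
move=> a0 b0 c0 d0; split.
- by rewrite -addeA leeDl ?adde_ge0.
- by rewrite -addeA addeCA leeDl ?adde_ge0.
- by rewrite addeCA leeDl ?adde_ge0.
- by rewrite addeA leeDr ?adde_ge0.
Qed.

Lemma eq_clip L (y z : env) t : (forall t, lin L y t = lin L z t) ->
  nrm ts (lin L z) <= n%:R -> clip L y t = lin L z t.
Proof.
move=> E H; rewrite /clip E (_ : nrm ts (lin L y) = nrm ts (lin L z)) ?H//.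
by apply: eq_bigr => s _; rewrite E.
Qed.

(** [y] is the codebook and [z] the codebook together with the noise. Either a transmitted codeword
    exceeds its budget, which a power score pays for, or clipping is inactive and the received words
    are the linear forms tested in [score_ge1]. *)
Lemma error_le_score (y z : env) m0 m1 m2 s : (forall i, i \notin ncoords -> z i = y i) ->
  s = noise_seq bZ1 bZ2 z ts ->
  ((if (dec1 (scheme_code y) (recv1 h11 h12 (scheme_code y) m0 m1 m2 s) != (m0, m1))
      || (dec2 (scheme_code y) (recv2 h21 h22 (scheme_code y) m0 m1 m2 s) != (m0, m2))
    then 1 else 0)%:E <= score_total m0 m1 m2 z)%E.
Proof.
move=> zy sE; apply: indicator_le; first exact: (nice_score_total m0 m1 m2).1.
have g1 : (0 <= scoreRx1 m0 m1 m2 z)%E by exact: (nice_score _ _ _ _ _ _ _ _ _ _ _ _ _ _).1.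
have g2 : (0 <= scoreRx2 m0 m1 m2 z)%E by exact: (nice_score _ _ _ _ _ _ _ _ _ _ _ _ _ _).1.
have g3 L : (0 <= (expR (score_power L z))%:E)%E by rewrite lee_fin expR_ge0.
have code_coord b t c : b != bZ1 -> b != bZ2 -> z (b, t, c) = y (b, t, c).
  by move=> /negbTE b1 /negbTE b2; apply: zy; rewrite mem_noise_coords b1 b2.
have E1 t : lin (word1 m0 m1) y t = lin (word1 m0 m1) z t.
  by apply: eq_lin => p c; rewrite !inE => /orP[] /eqP->; rewrite code_coord.
have E2 t : lin (word2 m0 m2) y t = lin (word2 m0 m2) z t.
  by apply: eq_lin => p c; rewrite !inE => /orP[] /eqP->; rewrite code_coord.
rewrite /score_total.
have [le1 le2 le3 le4] := le_sum4 g1 g2 (g3 (word1 m0 m1)) (g3 (word2 m0 m2)).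
have [P1 _|P1] := ltP n%:R (nrm ts (lin (word1 m0 m1) z)).
  exact: le_trans (score_power_ge1 P1) le3.
have [P2 _|P2] := ltP n%:R (nrm ts (lin (word2 m0 m2) z)).
  exact: le_trans (score_power_ge1 P2) le4.
have nths t : (t < n)%N -> nth (0, 0) s t = (letter z bZ1 t, letter z bZ2 t).
  move=> tn; rewrite sE /noise_seq (nth_map 0%N) ?size_iota ?subn0//.
  by rewrite nth_iota ?subn0.
have R1 t : (t < n)%N -> nth 0 (recv1 h11 h12 (scheme_code y) m0 m1 m2 s) t =
    lin (signal1 (m0, m1, u2 m2) ++ noise1 m0 m2) z t.
  move=> tn; rewrite receivedE1 -[t]/(val (Ordinal tn)) -tnth_nth tnth_mktuple /=.
  by rewrite (eq_clip _ E1)// (eq_clip _ E2)// nths.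
have R2 t : (t < n)%N -> nth 0 (recv2 h21 h22 (scheme_code y) m0 m1 m2 s) t =
    lin (signal2 (m0, m2, u1 m1) ++ noise2 m0 m1) z t.
  move=> tn; rewrite receivedE2 -[t]/(val (Ordinal tn)) -tnth_nth tnth_mktuple /=.
  by rewrite (eq_clip _ E1)// (eq_clip _ E2)// nths.
have T1 e : test1 y (nth 0 (recv1 h11 h12 (scheme_code y) m0 m1 m2 s)) e =
    test1 z (lin (signal1 (m0, m1, u2 m2) ++ noise1 m0 m2) z) e.
  apply: eq_test => // b t c _; rewrite /= !inE => /or3P[] /eqP->; by rewrite code_coord.
have T2 e : test2 y (nth 0 (recv2 h21 h22 (scheme_code y) m0 m1 m2 s)) e =
    test2 z (lin (signal2 (m0, m2, u1 m1) ++ noise2 m0 m1) z) e.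
  apply: eq_test => // b t c _; rewrite /= !inE => /or3P[] /eqP->; by rewrite code_coord.
case/orP => H.
  apply: (le_trans _ le1).
  apply: score_ge1 => //; [exact: pw_noise1|exact: var1_gt0|].
  apply: contraNT H; rewrite negb_or negbK => /andP[t0 nw]; apply/eqP.
  apply: (@decode_correct _ _ _ _ _ _ _ _ _ _ _ _ _ _ _ _ _ _ _ (m0, m1, u2 m2)).
    by rewrite T1.
  by under eq_existsb do rewrite T1.
apply: (le_trans _ le2).
apply: score_ge1 => //; [exact: pw_noise2|exact: var2_gt0|].
apply: contraNT H; rewrite negb_or negbK => /andP[t0 nw]; apply/eqP.
apply: (@decode_correct _ _ _ _ _ _ _ _ _ _ _ _ _ _ _ _ _ _ _ (m0, m2, u1 m1)).
  by rewrite T2.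
by under eq_existsb do rewrite T2.
Qed.

Definition code_blocks : seq block := [seq b <- enum block | (b != bZ1) && (b != bZ2)].
(** Noise comes last, hence innermost: for a fixed codebook the inner integral is the noise
    expectation of the error probability. *)
Definition all_coords := coordsL code_blocks ts ++ ncoords.

Lemma uniq_all_coords : uniq all_coords.
Proof.
have ub : uniq code_blocks by apply: filter_uniq; exact: enum_uniq.
rewrite cat_uniq uniq_coordsL ?iota_uniq//=.
rewrite uniq_noise_coords ?iota_uniq// andbT; apply/hasPn => -[[b t] c].
rewrite mem_noise_coords mem_coordsL mem_filter => /andP[/orP[] /eqP-> _];
  by rewrite eqxx ?andbF.
Qed.

Lemma mem_all_coords b t c : (t < n)%N -> (b, t, c) \in all_coords.
Proof.
move=> tn; rewrite mem_cat mem_coordsL mem_noise_coords mem_filter mem_enum.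
by rewrite mem_index_iota tn /= !andbT; case: (b == bZ1); case: (b == bZ2).
Qed.

Definition rate_power := expR (- mu1 / th) / (1 + - mu1).

Definition value1 (m0 : 'I_M0) (m1 : 'I_M1) (c2 : 'I_C2) : R :=
  receiver_bound u1 (h11 * aU1) (h11 * aV1) (h12 * aU2) n dl var1 (m0, m1, c2) mu1 mu2.
Definition value2 (m0 : 'I_M0) (m2 : 'I_M2) (c1 : 'I_C1) : R :=
  receiver_bound u2 (h22 * aU2) (h22 * aV2) (h21 * aU1) n dl var2 (m0, m2, c1) mu1 mu2.
Definition value m0 m1 m2 := value1 m0 m1 (u2 m2) + value2 m0 m2 (u1 m1) +
  (rate_power ^+ n + rate_power ^+ n).

Lemma Ex_power L x : uniq (unzip2 L) -> pw L = th ->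
  Ex all_coords (fun x => (expR (score_power L x))%:E) x = (rate_power ^+ n)%:E.
Proof.
move=> uL pL; have sz : size ts = n by rewrite size_iota subn0.
have := @Ex_lin R block (- mu1) (- mu1 / th) L ts all_coords x; rewrite sz pL; apply=> //.
- exact: iota_uniq.
- exact: uniq_all_coords.
- move=> [[b t] c]; rewrite mem_coordsL mem_index_iota => /andP[_ /andP[_ tn]].
  exact: mem_all_coords.
- by rewrite ltrN2.
Qed.

Lemma Ex_total m0 m1 m2 x : Ex all_coords (score_total m0 m1 m2) x = (value m0 m1 m2)%:E.
Proof.
have ns1 : nice (scoreRx1 m0 m1 m2) by exact: nice_score.
have ns2 : nice (scoreRx2 m0 m1 m2) by exact: nice_score.
have np L := nice_score_power L.
have e1 : Ex all_coords (scoreRx1 m0 m1 m2) x = (value1 m0 m1 (u2 m2))%:E.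
  apply: Ex_score => //; [by move=> p q [] ->|by move=> p q [] ->|by move=> p q [] ->|
    exact: pw_noise1|exact: var1_gt0|exact: uniq_all_coords|exact: mem_all_coords].
have e2 : Ex all_coords (scoreRx2 m0 m1 m2) x = (value2 m0 m2 (u1 m1))%:E.
  apply: Ex_score => //; [by move=> p q [] ->|by move=> p q [] ->|by move=> p q [] ->|
    exact: pw_noise2|exact: var2_gt0|exact: uniq_all_coords|exact: mem_all_coords].
rewrite ExD; [|exact: niceD|exact: niceD].
rewrite (ExD _ _ ns1 ns2) (ExD _ _ (np _) (np _)) e1 e2.
by rewrite (Ex_power _ _ (pw_word1 m0 m1))// (Ex_power _ _ (pw_word2 m0 m2)).
Qed.

Lemma scheme_exists (tot : R) : 0 < tot -> (forall m0 m1 m2, value m0 m1 m2 <= tot) ->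
  exists c : Defs.code n r0 r1 r2, (err_prob h11 h12 h21 h22 c <= (2 * tot)%:E)%E.
Proof.
move=> tot0 le_tot.
have K0 : 0 <= ((M0 * M1 * M2)%:R^-1 : R) by [].
pose avg x := (((M0 * M1 * M2)%:R^-1)%:E *
  (\sum_(m0 < M0) \sum_(m1 < M1) \sum_(m2 < M2) score_total m0 m1 m2 x))%E.
have n1 m0 m1 : nice (fun x => \sum_(m2 < M2) score_total m0 m1 m2 x)%E.
  by apply: nice_sum => m2; exact: nice_score_total.
have n2 m0 : nice (fun x => \sum_(m1 < M1) \sum_(m2 < M2) score_total m0 m1 m2 x)%E.
  exact: nice_sum.
have n3 : nice (fun x => \sum_(m0 < M0) \sum_(m1 < M1) \sum_(m2 < M2) score_total m0 m1 m2 x)%E.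
  exact: nice_sum.
have na : nice avg by exact: niceZ.
have lin_avg s x : Ex s avg x = (((M0 * M1 * M2)%:R^-1)%:E *
  (\sum_(m0 < M0) \sum_(m1 < M1) \sum_(m2 < M2) Ex s (score_total m0 m1 m2) x))%E.
  rewrite ExZ// Ex_sum//; congr (_ * _)%E; apply: eq_bigr => m0 _.
  rewrite Ex_sum//; apply: eq_bigr => m1 _.
  by rewrite Ex_sum// => m2; exact: nice_score_total.
(* The mean is at most [tot]; the factor 2 only creates the strict inequality used to extract a
   codebook. *)
have lt_avg : (Ex (coordsL code_blocks ts) (Ex ncoords avg) (fun=> 0%R) < (2 * tot)%:E)%E.
  rewrite -Ex_cat lin_avg.
  rewrite (_ : (\sum_(m0 < M0) _)%E =
      (\sum_(m0 < M0) \sum_(m1 < M1) \sum_(m2 < M2) value m0 m1 m2)%:E); last first.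
    rewrite -sumEFin; apply: eq_bigr => m0 _; rewrite -sumEFin; apply: eq_bigr => m1 _.
    by rewrite -sumEFin; apply: eq_bigr => m2 _; exact: Ex_total.
  rewrite -EFinM lte_fin; apply: (@le_lt_trans _ _ tot); last lra.
  rewrite ler_pdivrMl ?ltr0n ?muln_gt0 ?M0_gt0 ?M1_gt0//.
  apply: (@le_trans _ _ (\sum_(m0 < M0) \sum_(m1 < M1) \sum_(m2 < M2) tot)).
    by apply: ler_sum => i _; apply: ler_sum => j _; apply: ler_sum => k _.
  by rewrite mulr_natl (mulnC _ M2) (mulnC M0) !mulrnA !sumr_const !card_ord.
have [y ylt _] := Ex_lt_exists (fun x => Ex_ge0 _ _ na.1) lt_avg.
exists (scheme_code y); apply: le_trans (ltW ylt).
rewrite lin_avg; apply: lee_wpmul2l => //.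
apply: lee_sum => m0 _; apply: lee_sum => m1 _; apply: lee_sum => m2 _.
rewrite (@noise_expE _ block bZ1 bZ2 isT 0 n _ y).
have -> : iota 0 n = ts by rewrite /index_iota subn0.
apply: le_Ex => [z|z zy]; first by rewrite lee_fin; case: ifP.
exact: (error_le_score _ _ _ zy erefl).
Qed.

End Scheme.

(** * Rates and exponents *)

Section MessageCounts.
Variable R : realType.
Implicit Types (r p c : R) (n : nat).

Lemma nmsg_itv n r : ((nmsg n r)%:R : R) <= 2 `^ (n%:R * r) < (nmsg n r).+1%:R.
Proof.
have x0 : 0 <= 2 `^ (n%:R * r) by exact: powR_ge0.
rewrite /nmsg; have -> : `|Num.floor (2 `^ (n%:R * r))|%N = Num.trunc (2 `^ (n%:R * r)).
  by rewrite truncn_floor x0.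
exact: truncn_itv.
Qed.

Lemma two_powR_gt0 (x : R) : 0 < 2 `^ x.
Proof. by rewrite powR_gt0. Qed.

Lemma two_powR_ge1 (x : R) : 0 <= x -> 1 <= 2 `^ x.
Proof. by move=> x0; rewrite -[leLHS](powRr0 2) ler_powR// ler1n. Qed.

Lemma two_powRD (x y : R) : 2 `^ (x + y) = 2 `^ x * 2 `^ y.
Proof. by rewrite powRD// pnatr_eq0 implybT. Qed.

Lemma nmsg_gt0 n r : 0 <= r -> (0 < nmsg n r)%N.
Proof.
move=> r0; have /andP[_] := nmsg_itv n r.
rewrite lt0n; apply: contraTneq => ->; rewrite -leNgt.
by apply: two_powR_ge1; rewrite mulr_ge0.
Qed.

Lemma nmsg0 n : nmsg n (0 : R) = 1%N.
Proof. by rewrite /nmsg mulr0 powRr0 floor1. Qed.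

(** Division with remainder by [P]: the quotient is the public part, the remainder the private one.
    This works although the number of messages is a floor and need not factor; the factors 2 absorb
    the rounding. *)
Lemma message_split n p c : 0 <= p -> 0 <= c ->
  exists (C : nat) (u : 'I_(nmsg n (p + c)) -> 'I_C),
    [/\ C%:R <= 2 * 2 `^ (n%:R * c),
        forall k, (#|[set b | u b == k]%SET|)%:R <= 2 * 2 `^ (n%:R * p) :> R
      & p = 0 -> injective u].
Proof.
move=> p0 c0.
have cC (x : R) : 0 <= x -> (nmsg n x).+1%:R <= 2 * 2 `^ (n%:R * x).
  move=> x0; have /andP[le _] := nmsg_itv n x.
  have := two_powR_ge1 (mulr_ge0 (ler0n R n) x0); rewrite -addn1 natrD; lra.
(* The successor makes up for the floor. At [p = 0] the choice of 1 makes the quotient map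
   injective. *)
pose P := if p == 0 then 1%N else (nmsg n p).+1.
have P0 : (0 < P)%N by rewrite /P; case: ifP.
have lP : 2 `^ (n%:R * p) <= P%:R.
  rewrite /P; case: eqP => [->|_]; first by rewrite mulr0 powRr0.
  by have /andP[_ /ltW] := nmsg_itv n p.
have Pl : P%:R <= 2 * 2 `^ (n%:R * p).
  rewrite /P; case: eqP => [->|_]; last exact: cC.
  by rewrite mulr0 powRr0 mulr1 ler1n.
have uC (b : 'I_(nmsg n (p + c))) : (b %/ P < (nmsg n c).+1)%N.
  rewrite ltn_divLR// -(ltr_nat R) natrM.
  have /andP[lM _] := nmsg_itv n (p + c).
  have bM : (b%:R : R) < (nmsg n (p + c))%:R by rewrite ltr_nat.
  apply: (lt_le_trans bM); apply: (le_trans lM).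
  rewrite mulrDr two_powRD mulrC ler_pM ?powR_ge0//.
  by have /andP[_ /ltW] := nmsg_itv n c.
exists (nmsg n c).+1, (fun b => Ordinal (uC b)); split; first exact: cC.
- move=> k; apply: le_trans Pl; rewrite ler_nat.
  set A := [set b | _]%SET.
  pose f (b : 'I_(nmsg n (p + c))) : 'I_P := Ordinal (ltn_pmod b P0).
  have fi : {in A &, injective f}.
    move=> a b; rewrite !inE => /eqP ak /eqP bk /(congr1 val) /= ab.
    apply/val_inj; rewrite /= (divn_eq a P) (divn_eq b P) ab.
    by have /(congr1 val) /= -> : Ordinal (uC a) = Ordinal (uC b) by rewrite ak bk.
  by rewrite -(card_in_imset fi) (leq_trans (max_card _))// card_ord.
- move=> pz a b /(congr1 val) /=.
  have -> : P = 1%N by rewrite /P pz eqxx.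
  by rewrite !divn1; exact: val_inj.
Qed.

End MessageCounts.

(** * Exponential decay of the union bound *)

Section Exponents.
Variable R : realType.

(** Since [expR x] is at least [1 + x], it suffices that [(1 - m) * (1 + m * (1 + d))] exceed 1,
    which is the third hypothesis. *)
Lemma rate_noise_lt1 (d m : R) : 0 < m -> m < 1 -> m * (1 + d) < d -> 0 < 1 + d ->
  rate_noise d m < 1.
Proof.
move=> m0 m1 md d1; rewrite /rate_noise ltr_pdivrMr ?mul1r; last lra.
rewrite mulNr expRN invf_plt ?posrE ?expR_gt0//; last lra.
apply: lt_le_trans (expR_ge1Dx _).
rewrite -div1r ltr_pdivrMr; last lra.
nra.
Qed.

(** The bound [1 - x] for [expR (- x)] reduces this to [(1 - d + d ^ 2) * (1 + d) = 1 + d ^ 3 >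
    1]. *)
Lemma rate_type_lt1 (d : R) : 0 < d -> d < 1 -> rate_type d d < 1.
Proof.
move=> d0 d1; rewrite /rate_type ltr_pdivrMr ?mul1r; last lra.
have h := expR_ge1Dx (- (d * (1 - d))).
rewrite -[X in X < _]invrK -expRN invf_plt ?posrE ?expR_gt0//; last lra.
apply: lt_le_trans h; rewrite -div1r ltr_pdivrMr; last lra.
have : 0 < d ^+ 3 by rewrite exprn_gt0.
nra.
Qed.

Lemma exists_gap (J : eqType) (s : seq J) (f g : J -> R) :
  (forall j, j \in s -> f j = 0 \/ f j < g j) ->
  exists2 d, 0 < d & forall j, j \in s -> f j = 0 \/ f j + d <= g j.
Proof.
elim: s => [|j s IH] H; first by exists 1.
have [d d0 Hd] : exists2 d, 0 < d & forall j, j \in s -> f j = 0 \/ f j + d <= g j.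
  by apply: IH => k ks; apply: H; rewrite inE ks orbT.
have [fj|fj] := H j (mem_head _ _).
  exists d => // k; rewrite inE => /predU1P[->|]; [by left|exact: Hd].
exists (Num.min d (g j - f j)); first by rewrite lt_min d0 subr_gt0.
move=> k; rewrite inE => /predU1P[->|/Hd[]]; [right|by left|right].
  have := ge_min (g j - f j) d (g j - f j); rewrite lexx orbT => h; lra.
have := ge_min d d (g j - f j); rewrite lexx => h; lra.
Qed.

(* Exponential growth rate of the number of wrong triples of type [T]. *)
Definition type_rate (r0 p c c' : R) (T : bitseq) : R :=
  (if all id T then r0 else 0) + (p + (if head false T then c else 0))
   + (if last false T then c' else 0).

(** The constant is 21 = 1 + 4 + 16: the noise term, four residual terms, and four types of wrong
    triples with at most 4 times the nominal count each, since two rounded-up sizes may multiply. *)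
Lemma receiver_bound_le (I0 I1 J1 J2 : finType) (u : I1 -> J1) (gU gV gI : R[i]) n
    (dl v mu1 mu2 rho r0 p c c' : R) (e0 : I0 * I1 * J2) :
  0 <= r0 -> 0 <= p -> 0 <= c -> 0 <= c' ->
  (#|I0|)%:R <= 2 `^ (n%:R * r0) -> (r0 = 0 -> #|I0| = 1%N) ->
  (#|I1|)%:R <= 2 `^ (n%:R * (p + c)) -> (p + c = 0 -> #|I1| = 1%N) ->
  (#|J2|)%:R <= 2 * 2 `^ (n%:R * c') ->
  (forall k, (#|[set b | u b == k]%SET|)%:R <= 2 * 2 `^ (n%:R * p) :> R) ->
  (p = 0 -> injective u) ->
  0 < v -> 0 <= rate_noise dl mu1 <= rho -> 0 <= rate_type dl mu2 <= rho ->
  (forall T, T \in error_types ->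
     type_rate r0 p c c' T = 0 \/
     2 `^ type_rate r0 p c c' T * rate_wrong gU gV gI dl v T <= rho) ->
  receiver_bound u gU gV gI n dl v e0 mu1 mu2 <= 21 * rho ^+ n.
Proof.
move=> r00 p0 c0 c'0 cI0 cI0z cI1 cI1z cJ2 cu ui v0 /andP[rn0 rnr] /andP[rt0 rtr] HT.
have rho0 : 0 <= rho by exact: le_trans rnr.
have rw0 T : 0 <= rate_wrong gU gV gI dl v T.
  rewrite /rate_wrong mulr_ge0 ?expR_ge0// divr_ge0 ?(ltW v0)//.
  by rewrite addr_ge0 ?wrong_pw_ge0 ?(ltW v0).
have p2 x : 2 `^ (n%:R * x) = (2 `^ x) ^+ n :> R by rewrite mulrC powRrM powR_mulrn ?powR_ge0.
have key T : T \in error_types ->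
    (type_rate r0 p c c' T = 0 -> nwrong u e0 T = 0%N) ->
    (nwrong u e0 T)%:R <= 4 * 2 `^ (n%:R * type_rate r0 p c c' T) ->
    (nwrong u e0 T)%:R * rate_wrong gU gV gI dl v T ^+ n <= 4 * rho ^+ n.
  move=> TE nz le4; have [/nz ->|H] := HT _ TE; first by rewrite mul0r mulr_ge0 ?exprn_ge0.
  apply: (@le_trans _ _ (4 * 2 `^ (n%:R * type_rate r0 p c c' T) * rate_wrong gU gV gI dl v T ^+ n)).
    by rewrite ler_wpM2r ?exprn_ge0.
  rewrite -mulrA ler_wpM2l// p2 -exprMn lerXn2r ?nnegrE//.
  by apply: mulr_ge0 => //; exact: powR_ge0.
have np x : 0 < 2 `^ (n%:R * x) :> R by exact: two_powR_gt0.
rewrite /receiver_bound (sum_rate_wrong u e0 (fun T => rate_wrong gU gV gI dl v T ^+ n)).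
have b1 : rate_noise dl mu1 ^+ n <= rho ^+ n by rewrite lerXn2r ?nnegrE.
have b2 : rate_type dl mu2 ^+ n <= rho ^+ n by rewrite lerXn2r ?nnegrE.
rewrite /error_types !big_cons !big_nil.
have k1 := key [:: false; true; false] isT.
have k2 := key [:: true; true; false] isT.
have k3 := key [:: false; true; true] isT.
have k4 := key [:: true; true; true] isT.
rewrite /type_rate /= ?addr0 ?add0r in k1 k2 k3 k4.
have {}k1 : (nwrong u e0 [:: false; true; false])%:R *
    rate_wrong gU gV gI dl v [:: false; true; false] ^+ n <= 4 * rho ^+ n.
  apply: k1 => [pz|]; first exact: nwrong_private0 (ui pz).
  apply: (@le_trans _ _ (#|[set b | u b == u e0.1.2]%SET|)%:R).
    by rewrite ler_nat nwrong_private.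
  apply: (le_trans (cu _)); have := np p; lra.
have {}k2 : (nwrong u e0 [:: true; true; false])%:R *
    rate_wrong gU gV gI dl v [:: true; true; false] ^+ n <= 4 * rho ^+ n.
  apply: k2 => [pz|]; first by apply: nwrong_own0; rewrite cI1z.
  apply: (@le_trans _ _ (#|I1|)%:R); first by rewrite ler_nat nwrong_own.
  apply: (le_trans cI1); have := np (p + c); lra.
have {}k3 : (nwrong u e0 [:: false; true; true])%:R *
    rate_wrong gU gV gI dl v [:: false; true; true] ^+ n <= 4 * rho ^+ n.
  apply: k3 => [pz|]; first by apply: nwrong_private0 (ui _) => //; lra.
  apply: (@le_trans _ _ (#|[set b | u b == u e0.1.2]%SET| * #|J2|)%:R).
    by rewrite ler_nat nwrong_cross.
  rewrite natrM mulrDr two_powRD.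
  apply: (@le_trans _ _ ((2 * 2 `^ (n%:R * p)) * (2 * 2 `^ (n%:R * c')))).
    by rewrite ler_pM.
  by rewrite le_eqVlt; apply/orP; left; apply/eqP; ring.
have {}k4 : (nwrong u e0 [:: true; true; true])%:R *
    rate_wrong gU gV gI dl v [:: true; true; true] ^+ n <= 4 * rho ^+ n.
  apply: k4 => [pz|].
    by apply: nwrong_all0; rewrite ?cI0z ?cI1z//; lra.
  apply: (@le_trans _ _ (#|I0| * #|I1| * #|J2|)%:R); first by rewrite ler_nat nwrong_all.
  rewrite !natrM (mulrDr _ _ c') (mulrDr _ r0) 2!two_powRD.
  apply: (@le_trans _ _ (2 `^ (n%:R * r0) * 2 `^ (n%:R * (p + c)) * (2 * 2 `^ (n%:R * c')))).
    by rewrite !ler_pM ?mulr_ge0.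
  have := mulr_gt0 (mulr_gt0 (np r0) (np (p + c))) (np c'); lra.
have r0n : 0 <= rho ^+ n by exact: exprn_ge0.
lra.
Qed.

End Exponents.

(** * Choice of the parameters under strict rate conditions *)

Section StrictRates.
Variables (R : realType) (h11 h12 h21 h22 : R[i]).

Lemma noise_exp_ge0 k (phi : seq (R[i] * R[i]) -> \bar R) :
  (forall s, (0 <= phi s)%E) -> (0 <= noise_exp k phi)%E.
Proof.
elim: k phi => [|k IH] phi phi0 /=; first exact: phi0.
by do 4 (apply: integral_ge0 => ? _); exact: IH.
Qed.

Lemma wrong_type_rate (gU gV gI : R[i]) (v dl d r rho : R) T :
  0 < v -> r = 0 \/ r * ln 2 + d <= ln ((v + wrong_pw gU gV gI T) / v) ->
  4 * dl <= d -> expR (- (2 * dl)) <= rho ->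
  r = 0 \/ 2 `^ r * rate_wrong gU gV gI dl v T <= rho.
Proof.
move=> v0 [->|H] dd er; [by left|right].
have w0 : 0 < v + wrong_pw gU gV gI T by rewrite ltr_wpDr// wrong_pw_ge0.
apply: le_trans er; rewrite /rate_wrong.
have -> : v / (v + wrong_pw gU gV gI T) = expR (- ln ((v + wrong_pw gU gV gI T) / v)).
  by rewrite expRN lnK ?invf_div// posrE divr_gt0.
rewrite /powR pnatr_eq0 /= -!expRD ler_expR; lra.
Qed.

Lemma strict_achievable (th q1 q2 r0 p1 c1 p2 c2 : R) :
  0 < th -> th < 1 -> 0 <= q1 -> q1 <= 1 -> 0 <= q2 -> q2 <= 1 ->
  0 <= r0 -> 0 <= p1 -> 0 <= c1 -> 0 <= p2 -> 0 <= c2 ->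
  (forall T, T \in error_types -> type_rate r0 p1 c1 c2 T = 0 \/
     type_rate r0 p1 c1 c2 T * ln 2 <
     ln ((var1 h12 th q2 + wrong_pw (h11 * aU1 th q1) (h11 * aV1 th q1) (h12 * aU2 th q2) T)
        / var1 h12 th q2)) ->
  (forall T, T \in error_types -> type_rate r0 p2 c2 c1 T = 0 \/
     type_rate r0 p2 c2 c1 T * ln 2 <
     ln ((var2 h21 th q1 + wrong_pw (h22 * aU2 th q2) (h22 * aV2 th q2) (h21 * aU1 th q1) T)
        / var2 h21 th q1)) ->
  achievable h11 h12 h21 h22 r0 (p1 + c1) (p2 + c2).
Proof.
move=> th0 th1 q10 q11 q20 q21 r00 p10 c10 p20 c20 H1 H2.
have l2 : 0 < ln 2 :> R by rewrite ln_gt0// ltr1n.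
have v10 := var1_gt0 h12 th0 q20.
have v20 := var2_gt0 h21 th0 q10.
have gap (f g : bitseq -> R) : (forall T, T \in error_types -> f T = 0 \/ f T * ln 2 < g T) ->
    exists2 d, 0 < d & forall T, T \in error_types -> f T = 0 \/ f T * ln 2 + d <= g T.
  move=> H; have [|d d0 Hd] := @exists_gap R _ error_types (fun T => f T * ln 2) g.
    by move=> T /H[->|]; [left; rewrite mul0r|right].
  exists d => // T /Hd[/eqP|]; last by right.
  by rewrite mulf_eq0 (gt_eqF l2) orbF => /eqP; left.
have [d1 d10 {}H1] := gap _ (fun T => ln ((var1 h12 th q2 +
  wrong_pw (h11 * aU1 th q1) (h11 * aV1 th q1) (h12 * aU2 th q2) T) / var1 h12 th q2)) H1.
have [d2 d20 {}H2] := gap _ (fun T => ln ((var2 h21 th q1 +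
  wrong_pw (h22 * aU2 th q2) (h22 * aV2 th q2) (h21 * aU1 th q1) T) / var2 h21 th q1)) H2.
pose dl := Num.min (Num.min (d1 / 4) (d2 / 4)) 2^-1.
have dl0 : 0 < dl by rewrite !lt_min !divr_gt0//= invr_gt0.
have dl1 : dl <= 2^-1 by rewrite ge_min lexx orbT.
have dld1 : 4 * dl <= d1.
  by rewrite mulrC -ler_pdivlMr// ge_min ge_min lexx.
have dld2 : 4 * dl <= d2.
  by rewrite mulrC -ler_pdivlMr// ge_min ge_min lexx orbT.
have dl1' : dl < 1 by lra.
(* One tilt for two upper tails: the first bound handles the noise with slack [dl], the second the
   codeword energy with slack [th^-1 - 1]. *)
pose m1 := Num.min (dl / (2 * (1 + dl))) ((1 - th) / 2).
have m10 : 0 < m1 by rewrite lt_min !divr_gt0//; lra.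
have m1a : m1 * (1 + dl) < dl.
  have : m1 <= dl / (2 * (1 + dl)) by rewrite ge_min lexx.
  rewrite ler_pdivlMr; last lra.
  move=> h; lra.
have m1b : m1 < 1 - th.
  have : m1 <= (1 - th) / 2 by rewrite ge_min lexx orbT.
  lra.
have m11 : m1 < 1 by lra.
have rn1 : rate_noise dl m1 < 1 by apply: rate_noise_lt1 => //; lra.
have rt1 : rate_type dl dl < 1 by exact: rate_type_lt1.
have rpE : rate_power th m1 = rate_noise (th^-1 - 1) m1.
  by rewrite /rate_power /rate_noise subrKC.
have rp1 : rate_power th m1 < 1.
  rewrite rpE; apply: rate_noise_lt1 => //; rewrite subrKC ?invr_gt0//.
  rewrite ltrBrDr -[ltRHS]mul1r -ltr_pdivrMr ?invr_gt0// invrK mulrDl mul1r.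
  by rewrite divfK ?gt_eqF//; lra.
have rn0 : 0 <= rate_noise dl m1 by rewrite mulr_ge0 ?expR_ge0// invr_ge0; lra.
have rt0 : 0 <= rate_type dl dl by rewrite mulr_ge0 ?expR_ge0// invr_ge0; lra.
have rp0 : 0 <= rate_power th m1 by rewrite mulr_ge0 ?expR_ge0// invr_ge0; lra.
pose rho := Num.max (Num.max (rate_noise dl m1) (rate_type dl dl))
                    (Num.max (rate_power th m1) (expR (- (2 * dl)))).
have rho1 : rho < 1.
  by rewrite !gt_max rn1 rt1 rp1 expR_lt1/=; lra.
have rho_n : rate_noise dl m1 <= rho by rewrite !le_max lexx.
have rho_t : rate_type dl dl <= rho by rewrite !le_max lexx orbT.
have rho_p : rate_power th m1 <= rho by rewrite !le_max lexx !orbT.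
have rho_e : expR (- (2 * dl)) <= rho by rewrite !le_max lexx !orbT.
have rho0 : 0 < rho by rewrite (lt_le_trans _ rho_e)// expR_gt0.
(* 88 = 2 * (21 + 21 + 2): both receivers and two power terms, doubled when the codebook is
   fixed. *)
have codes n : exists c : Defs.code n r0 (p1 + c1) (p2 + c2),
    (err_prob h11 h12 h21 h22 c <= (88 * rho ^+ n)%:E)%E.
  have [C1 [u1 [C1c u1f u1i]]] := message_split n p10 c10.
  have [C2 [u2 [C2c u2f u2i]]] := message_split n p20 c20.
  have M0 := nmsg_gt0 n r00.
  have M1 := nmsg_gt0 n (addr_ge0 p10 c10).
  have M2 := nmsg_gt0 n (addr_ge0 p20 c20).
  have tot0 : 0 < 44 * rho ^+ n by rewrite mulr_gt0// exprn_gt0.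
  have cM (r : R) : (nmsg n r)%:R <= 2 `^ (n%:R * r) by have /andP[] := nmsg_itv n r.
  have cM0 (r : R) : r = 0 -> nmsg n r = 1%N by move=> ->; exact: nmsg0.
  have -> : 88 * rho ^+ n = 2 * (44 * rho ^+ n) by lra.
  have := @scheme_exists R h11 h12 h21 h22 n r0 _ _ M0 M1 M2 C1 C2 u1 u2 th q1 q2 dl m1 dl
    th0 q10 q11 q20 q21 (ltW m10) m11 (ltW dl0) _ tot0.
  apply => m0 m1' m2; rewrite /value.
  have b1 : value1 h11 h12 u1 th q1 q2 dl m1 dl m0 m1' (u2 m2) <= 21 * rho ^+ n.
    apply: (@receiver_bound_le _ _ _ _ _ _ _ _ _ _ _ _ _ _ _ r0 p1 c1 c2) => //;
      rewrite ?card_ord ?rn0 ?rt0//.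
    - exact: cM0.
    - exact: cM0.
    - by move=> T /H1 H; apply: wrong_type_rate H _ _.
  have b2 : value2 h21 h22 u2 th q1 q2 dl m1 dl m0 m2 (u1 m1') <= 21 * rho ^+ n.
    apply: (@receiver_bound_le _ _ _ _ _ _ _ _ _ _ _ _ _ _ _ r0 p2 c2 c1) => //;
      rewrite ?card_ord ?rn0 ?rt0//.
    - exact: cM0.
    - exact: cM0.
    - by move=> T /H2 H; apply: wrong_type_rate H _ _.
  have b3 : rate_power th m1 ^+ n <= rho ^+ n by rewrite lerXn2r ?nnegrE// ltW.
  lra.
split=> //; split; first exact: addr_ge0.
split; first exact: addr_ge0.
exists (fun n => projT1 (cid (codes n))).
apply: (@squeeze_cvge _ _ _ _ (fun=> 0%E) _ (fun n => (88 * rho ^+ n)%:E)).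
- near=> n; rewrite (projT2 (cid (codes n))) andbT.
  rewrite /err_prob mule_ge0// ?lee_fin ?invr_ge0//.
  do 3 (apply: sume_ge0 => ? _).
  by apply: noise_exp_ge0 => s; rewrite lee_fin; case: ifP.
- exact: cvg_cst.
- apply: cvg_EFin; first by near=> n.
  rewrite -(mulr0 88); apply: cvgMr; apply: cvg_expr.
  by rewrite ger0_norm// ltW.
Unshelve. all: by end_near.
Qed.

End StrictRates.

(** * The rate region *)

Section Region.
Variable R : realType.
Local Notation Ccap := (@Ccap R).

Lemma ln2_gt0 : 0 < ln 2 :> R.
Proof. by rewrite ln_gt0// ltr1n. Qed.

(** The tangent bound of [ln] at [1 + t * x] is applied at [1 + x] and at 1; with weights [t] and
    [1 - t] the linear terms cancel. *)
Lemma ln_concave (t x : R) : 0 <= t -> t <= 1 -> 0 <= x -> t * ln (1 + x) <= ln (1 + t * x).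
Proof.
move=> t0 t1 x0; have tx := mulr_ge0 t0 x0.
have A0 : 0 < 1 + t * x by lra.
have lnb (y : R) : 0 < y -> ln y - ln (1 + t * x) <= y / (1 + t * x) - 1.
  move=> y0; rewrite -ln_div ?posrE//.
  have := @le_ln1Dx R (y / (1 + t * x) - 1); rewrite subrKC; apply.
  by have := divr_gt0 y0 A0; lra.
have h1 := ler_wpM2l t0 (lnb (1 + x) ltac:(lra)).
have t1' : 0 <= 1 - t by lra.
have h2 := ler_wpM2l t1' (lnb 1 ltac:(lra)).
have E : t * ((1 + x) / (1 + t * x) - 1) + (1 - t) * (1 / (1 + t * x) - 1) = 0.
  by field; rewrite gt_eqF.
rewrite ln1 in h2; lra.
Qed.

(** The rate drops by [k], the capacity by no worse than [th > k]: concavity covers the signal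
    power, and scaling the interference [N] by [th] as well only helps. *)
Lemma scaled_rate (th k r S N : R) : 0 < k -> k < th -> th <= 1 -> 0 <= S -> 0 <= N -> 0 <= r ->
  r <= Ccap (S / (1 + N)) ->
  k * r = 0 \/ k * r * ln 2 < ln ((th * N + 1 + th * S) / (th * N + 1)).
Proof.
move=> k0 kt t1 S0 N0 r0 rC; have [->|rn0] := eqVneq r 0; first by left; rewrite mulr0.
right; have {}r0 : 0 < r by rewrite lt_def rn0.
have th0 : 0 < th by lra.
have N1 : 0 < 1 + N by lra.
have tN : 0 <= th * N by rewrite mulr_ge0// ltW.
have x0 : 0 <= S / (1 + N) by rewrite divr_ge0// ltW.
apply: (@lt_le_trans _ _ (th * ln (1 + S / (1 + N)))).
  apply: (@lt_le_trans _ _ (th * (r * ln 2))).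
    by rewrite -mulrA ltr_pM2r// mulr_gt0// ln2_gt0.
  by rewrite ler_pM2l//; move: rC; rewrite /Defs.Ccap ler_pdivlMr// ln2_gt0.
apply: (le_trans (ln_concave (ltW th0) t1 x0)).
rewrite ler_ln ?posrE.
- rewrite [leRHS]mulrDl divff; last by rewrite gt_eqF//; lra.
  rewrite lerD2l -mulrA ler_wpM2l ?(ltW th0)// ler_wpM2l// lef_pV2 ?posrE; [|lra|lra].
  have : th * N <= N by rewrite ler_piMl.
  lra.
- have := mulr_ge0 (ltW th0) x0; lra.
- rewrite divr_gt0//; [|lra].
  have := mulr_ge0 (ltW th0) S0; lra.
Qed.

(** One condition per entry of [error_types], in that order; they yield [A], [D], [E] and [G]. Here
    [a] and [b] are the direct and cross gains, [q] and [q'] the private power shares of the own and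
    the interfering user. *)
Definition receiver_ok (a b q q' r0 p c c' : R) : Prop :=
  [/\ p <= Ccap (a * q / (1 + b * q')), p + c <= Ccap (a / (1 + b * q')),
      p + c' <= Ccap ((a * q + b * (1 - q')) / (1 + b * q'))
    & r0 + p + c + c' <= Ccap ((a + b * (1 - q')) / (1 + b * q'))].

Lemma receiver_ok_strict (hU hI : R[i]) (th k q q' r0 p c c' v : R) :
  0 < k -> k < th -> th <= 1 -> 0 <= q -> q <= 1 -> 0 <= q' -> q' <= 1 ->
  0 <= r0 -> 0 <= p -> 0 <= c -> 0 <= c' ->
  v = sqmod hI * (th * q') + 1 ->
  receiver_ok (sqmod hU) (sqmod hI) q q' r0 p c c' ->
  forall T, T \in error_types -> type_rate (k * r0) (k * p) (k * c) (k * c') T = 0 \/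
     type_rate (k * r0) (k * p) (k * c) (k * c') T * ln 2 <
     ln ((v + wrong_pw (hU * amp (th * (1 - q))) (hU * amp (th * q)) (hI * amp (th * (1 - q'))) T) / v).
Proof.
move=> k0 kt t1 q0 q1 q'0 q'1 r00 p0 c0 c'0 -> [oA oD oE oG].
set a := sqmod hU in oA oD oE oG *; set b := sqmod hI in oA oD oE oG *.
have a0 : 0 <= a := sqmod_ge0 hU.
have b0 : 0 <= b := sqmod_ge0 hI.
have th0 : 0 <= th by lra.
have N0 : 0 <= b * q' by exact: mulr_ge0.
have sc (r S : R) : 0 <= S -> 0 <= r -> r <= Ccap (S / (1 + b * q')) ->
    k * r = 0 \/ k * r * ln 2 < ln ((b * (th * q') + 1 + th * S) / (b * (th * q') + 1)).
  by move=> S0 r0' H; rewrite mulrCA; exact: scaled_rate.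
have aq := mulr_ge0 a0 q0.
have bq : 0 <= b * (1 - q') by rewrite mulr_ge0// subr_ge0.
have tq : 0 <= th * q by exact: mulr_ge0.
have tq1 : 0 <= th * (1 - q) by rewrite mulr_ge0// subr_ge0.
have tq2 : 0 <= th * (1 - q') by rewrite mulr_ge0// subr_ge0.
move=> T; rewrite !inE => /or4P[] /eqP->; rewrite /type_rate /wrong_pw /= ?big_cons big_nil
  !sqmodM ?(sqmod_amp tq) ?(sqmod_amp tq1) ?(sqmod_amp tq2) -/a -/b.
- have := sc _ _ aq p0 oA.
  have -> : th * (a * q) = a * (th * q) + 0 by ring.
  by rewrite !addr0 add0r.
- have := sc _ _ a0 (addr_ge0 p0 c0) oD.
  have -> : th * a = a * (th * (1 - q)) + (a * (th * q) + 0) by ring.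
  by rewrite mulrDr !addr0 add0r.
- have := sc _ _ (addr_ge0 aq bq) (addr_ge0 p0 c'0) oE.
  have -> : th * (a * q + b * (1 - q')) = a * (th * q) + (b * (th * (1 - q')) + 0) by ring.
  by rewrite mulrDr !addr0 add0r.
- have := sc _ _ (addr_ge0 a0 bq) (addr_ge0 (addr_ge0 (addr_ge0 r00 p0) c0) c'0) oG.
  have -> : th * (a + b * (1 - q')) =
     a * (th * (1 - q)) + (a * (th * q) + (b * (th * (1 - q')) + 0)) by ring.
  by rewrite !mulrDr !addrA.
Qed.

(** Approaching along the ray from the origin keeps vanishing rates at zero, which the alternatives
    for zero rates rely on. *)
Lemma closure_scaled (E : set (R * R * R)) (r : R * R * R) :
  (forall k : R, 0 < k -> k < 1 -> E (k * r.1.1, k * r.1.2, k * r.2)) -> closure E r.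
Proof.
move=> HE; case: r HE => [[r0 r1] r2] HE B Bn.
have C (s : R) : (k * s) @[k --> (1 : R)^'-] --> s.
  rewrite -[X in _ --> X]mul1r; apply: cvgMl.
  exact: cvg_at_left_filter.
have H : (fun k : R => (k * r0, k * r1, k * r2)) @ (1 : R)^'- --> ((r0, r1), r2).
  exact: (cvg_pair (cvg_pair (C r0) (C r1)) (C r2)).
have H1 := H _ Bn.
have : \forall k \near (1 : R)^'-, 0 < k /\ k < 1 /\ B (k * r0, k * r1, k * r2).
  near=> k; split; [by near: k; exact: nbhs_left_gt|split=> //].
  by near: k; exact: H1.
move=> /filter_ex[k [k0 [k1 Bk]]].
by exists (k * r0, k * r1, k * r2); split=> //; exact: HE.
Unshelve. all: by end_near.
Qed.

Lemma scheme_capacity (h11 h12 h21 h22 : R[i]) (q1 q2 r0 p1 c1 p2 c2 : R) :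
  0 <= q1 -> q1 <= 1 -> 0 <= q2 -> q2 <= 1 ->
  0 <= r0 -> 0 <= p1 -> 0 <= c1 -> 0 <= p2 -> 0 <= c2 ->
  receiver_ok (sqmod h11) (sqmod h12) q1 q2 r0 p1 c1 c2 ->
  receiver_ok (sqmod h22) (sqmod h21) q2 q1 r0 p2 c2 c1 ->
  capacity_region h11 h12 h21 h22 (r0, p1 + c1, p2 + c2).
Proof.
move=> q10 q11 q20 q21 r00 p10 c10 p20 c20 ok1 ok2.
apply: closure_scaled => k k0 k1 /=; rewrite !mulrDr.
have kp x : 0 <= x -> 0 <= k * x by move=> x0; rewrite mulr_ge0// ltW.
pose th := (1 + k) / 2.
apply: (@strict_achievable _ _ _ _ _ th q1 q2) => //; rewrite ?kp//; try (rewrite /th; lra).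
- by apply: receiver_ok_strict ok1 => //; rewrite /th; lra.
- by apply: receiver_ok_strict ok2 => //; rewrite /th; lra.
Qed.

End Region.

(** * Elimination of the private rates and conclusion *)

Section InnerBound.
Variable R : realType.
Local Notation Ccap := (@Ccap R).

Lemma le_Ccap (x y : R) : 0 <= x -> x <= y -> Ccap x <= Ccap y.
Proof.
move=> x0 xy; rewrite /Defs.Ccap ler_pM2r ?invr_gt0 ?ln2_gt0// ler_ln ?posrE; lra.
Qed.

Lemma Ccap_ge0 (x : R) : 0 <= x -> 0 <= Ccap x.
Proof.
by move=> x0; rewrite /Defs.Ccap divr_ge0 ?(ltW (ln2_gt0 R))// ln_ge0// lerDl.
Qed.

Lemma Ccap_le_add (x y z : R) : 0 <= x -> 0 <= y -> 0 <= z -> 1 + x <= (1 + y) * (1 + z) ->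
  Ccap x <= Ccap y + Ccap z.
Proof.
move=> x0 y0 z0 H; rewrite /Defs.Ccap -mulrDl ler_pM2r ?invr_gt0 ?ln2_gt0//.
rewrite -lnM ?posrE; [|lra|lra].
by rewrite ler_ln ?posrE ?mulr_gt0//; lra.
Qed.

(** The attainable differences fill [[l1 - u2, u1 - l2]], which meets [[lo, hi]]. [d] is the least
    common difference, and [p] the least point of the first interval that also lies in the second
    one shifted by [d]. *)
Lemma two_intervals (l1 u1 l2 u2 lo hi : R) :
  l1 <= u1 -> l2 <= u2 -> lo <= hi -> lo <= u1 - l2 -> l1 - u2 <= hi ->
  exists p1 p2, [/\ l1 <= p1 <= u1, l2 <= p2 <= u2 & lo <= p1 - p2 <= hi].
Proof.
move=> h1 h2 h3 h4 h5.
pose d := Num.max lo (l1 - u2).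
have d1 : lo <= d by rewrite le_max lexx.
have d2 : l1 - u2 <= d by rewrite le_max lexx orbT.
have d3 : d <= hi by rewrite ge_max h3 h5.
have d4 : d <= u1 - l2 by rewrite ge_max h4; lra.
pose p := Num.max l1 (l2 + d).
have p1 : l1 <= p by rewrite le_max lexx.
have p2 : l2 + d <= p by rewrite le_max lexx orbT.
have p3 : p <= u1 by rewrite ge_max h1; lra.
have p4 : p <= u2 + d by rewrite ge_max; lra.
exists p, (p - d); split; lra.
Qed.

(* The public rate of user [i] is [r_i - p_i]; eliminating the private rates [p1], [p2]
   leaves two further inequalities, [r1 <= A1 + E2] and [r2 <= A2 + E1]. *)
Lemma private_rates (r0 r1 r2 A1 A2 E1 E2 G1 G2 : R) :
  0 <= r0 -> 0 <= r1 -> 0 <= r2 -> 0 <= A1 -> 0 <= A2 -> A1 <= E1 -> A2 <= E2 ->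
  r0 + r1 <= G1 -> r0 + r2 <= G2 -> r1 + r2 <= E1 + E2 ->
  r0 + r1 + r2 <= A1 + G2 -> r0 + r1 + r2 <= A2 + G1 ->
  r0 + 2 * r1 + r2 <= A1 + G1 + E2 -> r0 + r1 + 2 * r2 <= A2 + G2 + E1 ->
  r1 <= A1 + E2 -> r2 <= A2 + E1 ->
  exists p1 p2, [/\ 0 <= p1 <= r1, 0 <= p2 <= r2, p1 <= A1 /\ p2 <= A2,
    p1 + (r2 - p2) <= E1 /\ p2 + (r1 - p1) <= E2
    & r0 + r1 + (r2 - p2) <= G1 /\ r0 + r2 + (r1 - p1) <= G2].
Proof.
move=> r00 r10 r20 A10 A20 AE1 AE2 H1 H2 H3 H4 H5 H6 H7 H8 H9.
have [s sE] : exists s, s = r0 + r1 + r2 by exists (r0 + r1 + r2).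
(* The conditions with [G1] and [G2] bound [p2] and [p1] from below, and those with [E1] and [E2]
   bound only [p1 - p2]. The two extra inequalities come from comparing these difference bounds with
   the extreme values of [p1] and [p2]. *)
have [|||||p1 [p2 [/andP[a1 b1] /andP[a2 b2] /andP[c d]]]] :=
  @two_intervals (Num.max 0 (s - G2)) (Num.min A1 r1) (Num.max 0 (s - G1)) (Num.min A2 r2)
    (r1 - E2) (E1 - r2).
- by case: (leP 0 (s - G2)); case: (leP A1 r1) ; lra.
- by case: (leP 0 (s - G1)); case: (leP A2 r2) ; lra.
- lra.
- by case: (leP 0 (s - G1)); case: (leP A1 r1) ; lra.
- by case: (leP 0 (s - G2)); case: (leP A2 r2) ; lra.
move: a1 b1 a2 b2; rewrite !ge_max !le_min sE.
move=> /andP[a1 a1'] /andP[b1 b1'] /andP[a2 a2'] /andP[b2 b2'].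
by exists p1, p2; split; try split; lra.
Qed.

Lemma private_fraction (a : R) : 0 <= a ->
  0 <= (if a <= 1 then 1 else a^-1) <= 1.
Proof.
move=> a0; case: (leP a 1) => a1; first by rewrite ler01 lexx.
by rewrite invr_ge0 a0 invf_le1 ?(ltW a1)// (lt_trans ltr01).
Qed.

(* Treating the whole of [X1] as noise, receiver 2 still decodes at any rate below [G2 - E2]. *)
Lemma all_private_rate (a21 a22 x12 x21 : R) : 0 <= a21 -> 0 <= a22 ->
  0 <= x12 -> 0 <= x21 -> x21 <= 1 ->
  Ccap ((a22 + a21 * (1 - x21)) / (1 + a21 * x21)) <=
  Ccap ((a22 * x12 + a21 * (1 - x21)) / (1 + a21 * x21)) + Ccap (a22 / (1 + a21)).
Proof.
move=> a210 a220 x120 x210 x211.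
have N0 : 0 < 1 + a21 * x21 by have := mulr_ge0 a210 x210; lra.
have N1 : 0 < 1 + a21 by lra.
have b0 : 0 <= a21 * (1 - x21) by rewrite mulr_ge0// subr_ge0.
have c0 := mulr_ge0 a220 x120.
apply: (Ccap_le_add (divr_ge0 (addr_ge0 a220 b0) (ltW N0))
  (divr_ge0 (addr_ge0 c0 b0) (ltW N0)) (divr_ge0 a220 (ltW N1))).
have -> : 1 + (a22 + a21 * (1 - x21)) / (1 + a21 * x21) = (1 + a21 + a22) / (1 + a21 * x21).
  by field; rewrite gt_eqF.
have -> : (1 + (a22 * x12 + a21 * (1 - x21)) / (1 + a21 * x21)) * (1 + a22 / (1 + a21)) =
   ((1 + a21 + a22) + (a22 * x12) * (1 + a21 + a22) / (1 + a21)) / (1 + a21 * x21).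
  by field; rewrite !gt_eqF.
rewrite ler_pM2r ?invr_gt0// lerDl divr_ge0 ?mulr_ge0//; lra.
Qed.

End InnerBound.

Unset Implicit Arguments.

Theorem theorem2 (R : realType) (h11 h12 h21 h22 : R[i]) :
  C_inner h11 h12 h21 h22 `<=` capacity_region h11 h12 h21 h22.
Proof.
move=> [[r0 r1] r2] [r00 [r10 [r20 []]]].
rewrite /G1' /G2' /A1 /A2 /D1 /D2 /E1 /E2 /G1 /G2.
set a11 := sqmod h11; set a12 := sqmod h12; set a21 := sqmod h21; set a22 := sqmod h22.
have a110 : 0 <= a11 := sqmod_ge0 h11.
have a120 : 0 <= a12 := sqmod_ge0 h12.
have a210 : 0 <= a21 := sqmod_ge0 h21.
have a220 : 0 <= a22 := sqmod_ge0 h22.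
have /andP[] := private_fraction a210; rewrite -/(x21 h21).
have /andP[] := private_fraction a120; rewrite -/(x12 h12).
move: (x21 h21) (x12 h12) => {}x21 {}x12 x120 x121 x210 x211.
have n1 := mulr_ge0 a120 x120; have n2 := mulr_ge0 a210 x210.
have m1 : 0 <= a12 * (1 - x12) by rewrite mulr_ge0// subr_ge0.
have m2 : 0 <= a21 * (1 - x21) by rewrite mulr_ge0// subr_ge0.
have s1 := mulr_ge0 a110 x210; have s2 := mulr_ge0 a220 x120.
have N1 : 0 < 1 + a12 * x12 by lra.
have N2 : 0 < 1 + a21 * x21 by lra.
(* The arguments of [G1'] and [G1] are the same number, as are those of [G2'] and [G2] below. *)
have -> : (1 + a11 + a12) / (1 + a12 * x12) - 1 = (a11 + a12 * (1 - x12)) / (1 + a12 * x12).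
  by field; rewrite gt_eqF.
have -> : (1 + a22 + a21) / (1 + a21 * x21) - 1 = (a22 + a21 * (1 - x21)) / (1 + a21 * x21).
  by field; rewrite gt_eqF.
set A1 := Ccap (a11 * x21 / _); set A2 := Ccap (a22 * x12 / _).
set D1 := Ccap (a11 / _); set D2 := Ccap (a22 / _).
set E1 := Ccap ((a11 * x21 + _) / _); set E2 := Ccap ((a22 * x12 + _) / _).
set G1 := Ccap ((a11 + _) / _); set G2 := Ccap ((a22 + _) / _).
move=> H1 [H2 [H3 [H4 [H5 [_ [_ [H6 [H7 [_ [_ [H8 H9]]]]]]]]]]].
have A10 : 0 <= A1 by rewrite Ccap_ge0// divr_ge0// ltW.
have A20 : 0 <= A2 by rewrite Ccap_ge0// divr_ge0// ltW.
have AE1 : A1 <= E1.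
  by apply: le_Ccap; rewrite ?divr_ge0 ?(ltW N1)// ler_pM2r ?invr_gt0// lerDl.
have AE2 : A2 <= E2.
  by apply: le_Ccap; rewrite ?divr_ge0 ?(ltW N2)// ler_pM2r ?invr_gt0// lerDl.
have [c1|c1] := leP r1 (A1 + E2); last first.
  (* Private rates [r1] and 0, public rates 0 and [r2]. Against [r1 > A1 + E2], the bound on
     [r0 + 2 * r1 + r2] leaves [r0 + r1 + r2 < G1] for receiver 1, and that on [r0 + r1 + r2] leaves
     [r0 + r2 < G2 - E2] for receiver 2. *)
  rewrite -[r1]addr0 -[X in (_, X)]add0r.
  have := all_private_rate a210 a220 x120 x210 x211; rewrite -/G2 -/E2 => P.
  apply: (@scheme_capacity _ _ _ _ _ 1 x12) => //; split;
    rewrite -/a11 -/a12 -/a21 -/a22 ?mulr1 ?addr0 ?add0r ?subrr ?mulr0 ?addr0 -/D1 -/G1 //.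
  - lra.
  - lra.
  - rewrite Ccap_ge0// divr_ge0//; lra.
  - lra.
  - rewrite Ccap_ge0// divr_ge0//; lra.
  - lra.
have [c2|c2] := leP r2 (A2 + E1); last first.
  (* The mirror case: user 2 is entirely private, user 1 entirely public. *)
  rewrite -[r2]addr0 -[X in (_, X, _)]add0r.
  have := all_private_rate a120 a110 x210 x120 x121; rewrite -/G1 -/E1 => P.
  apply: (@scheme_capacity _ _ _ _ _ x21 1) => //; split;
    rewrite -/a11 -/a12 -/a21 -/a22 ?mulr1 ?addr0 ?add0r ?subrr ?mulr0 ?addr0 -/D2 -/G2 //.
  - rewrite Ccap_ge0// divr_ge0//; lra.
  - lra.
  - rewrite Ccap_ge0// divr_ge0//; lra.
  - lra.
  - lra.
  - lra.
have [p1 [p2 [/andP[p10 p11] /andP[p20 p21] [pA1 pA2] [pE1 pE2] [pG1 pG2]]]] :=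
  private_rates r00 r10 r20 A10 A20 AE1 AE2 H1 H2 H5 H6 H7 H8 H9 c1 c2.
rewrite -(subrKC p1 r1) -(subrKC p2 r2).
apply: (@scheme_capacity _ _ _ _ _ x21 x12) => //; rewrite ?subr_ge0//.
- split; rewrite -/a11 -/a12 -/A1 -/D1 -/E1 -/G1//; lra.
- split; rewrite -/a22 -/a21 -/A2 -/D2 -/E2 -/G2//; lra.
Qed.
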